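(* Let $D\subset\mathbb{C}^n$ be a bounded, polynomially convex Reinhardt domain, and let $G$ be the pluricomplex Green function of $D$ with pole at $0$. Then there exists a sequence of mappings $P^{(s)}=(P^{(s)}_1,\ldots,P^{(s)}_n):\mathbb{C}^n\to\mathbb{C}^n$, $s=1,2,\ldots$, such that for each $s$ the components $P^{(s)}_1,\ldots,P^{(s)}_n$ are homogeneous polynomials of the same degree $q_s$ whose only common zero is $0$, and such that: (1) the functions $v_s=q_s^{-1}\max_{1\le k\le n}\log|P^{(s)}_k|$ converge to $G$ uniformly on $D\setminus\{0\}$ as $s\to\infty$; (2) the functions $v_s^+=\max\{v_s,0\}$ converge, uniformly on $\mathbb{C}^n$, to the Green function of the compact set $\overline D$ with pole at infinity.
   Context: A domain $D\subset\mathbb{C}^n$ is Reinhardt ($n$-circled, multicircled) if $(z_1,\ldots,z_n)\in D$ implies $(e^{i\phi_1}z_1,\ldots,e^{i\phi_n}z_n)\in D$ for all real $\phi_1,\ldots,\phi_n$. For a bounded Reinhardt domain, being polynomially convex amounts to being complete (if $z\in D$ and $|w_k|\le|z_k|$ for all $k$, then $w\in D$) and logarithmically convex (the set $\log|D|=\{(\log|z_1|,\ldots,\log|z_n|): z\in D,\ z_1\cdots z_n\neq0\}\subset\mathbb{R}^n$ is convex). In particular $0\in D$. The pluricomplex Green function of a bounded hyperconvex domain $D$ with pole at $a\in D$ is the upper envelope (pointwise supremum) of the negative plurisubharmonic functions $u$ in $D$ such that $u(z)\le\log|z-a|+O(1)$ as $z\to a$. The Green function of a compact set $K\subset\mathbb{C}^n$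 (here $K=\overline D$) with pole at infinity is the upper envelope of all plurisubharmonic functions $u$ on $\mathbb{C}^n$ with $u\le 0$ on $K$ and $u(z)\le\log(1+|z|)+C_u$ on $\mathbb{C}^n$ for some constant $C_u$. *)

(* Defs.v *)
From HB Require Import structures.
From mathcomp Require Import all_boot all_order all_algebra.
From mathcomp Require Import complex.
From mathcomp Require Import all_classical all_reals all_analysis.
(* The notations of mpoly clash with those of mathcomp-analysis.  Without them,
   mpoly n K is {mpoly K[n]}, meval v p is p.@[v], and ishomog1 d mdeg is
   d.-homog. *)
From mathcomp Require Import -(notations) mpoly.

Set Implicit Arguments.
Unset Strict Implicit.
Unset Printing Implicit Defensive.

Import Order.TTheory GRing.Theory Num.Theory numFieldNormedType.Exports.
Import ComplexField.Normc.
Local Open Scope classical_set_scope.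
Local Open Scope ring_scope.

(* mathcomp-analysis topologizes any abstract numFieldType by its norm;
   these instances do the same for the concrete field R[i], and thereby
   equip 'rV[R[i]]_n with the usual topology of C^n. *)
Section complex_topology.
Variable R : rcfType.
HB.instance Definition _ := PseudoPointedMetric.copy R[i] (R[i])^o.
HB.instance Definition _ := NormedModule.copy R[i] (R[i])^o.
End complex_topology.

Section complex_space.
Context {R : realType} {n : nat}.
Implicit Types (D K : set 'rV[R[i]]_n) (z : 'rV[R[i]]_n).

Definition expi (t : R) : R[i] := (cos t +i* sin t)%C.

(* Euclidean norm; the norm `|z| of 'rV[R[i]]_n is the sup norm. *)
Definition enorm z : R := Num.sqrt (\sum_k normc (z ord0 k) ^+ 2).

Definition peval (p : mpoly n R[i]) z : R[i] := meval (z ord0) p.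

Definition domain D := [/\ open D, connected D & D !=set0].

Definition reinhardt D := forall z (phi : 'I_n -> R),
  D z -> D (\row_k (expi (phi k) * z ord0 k)).

Definition polynomial_hull K : set 'rV[R[i]]_n :=
  [set z | forall p, normc (peval p z) <= sup [set normc (peval p w) | w in K]].

Definition polynomially_convex D :=
  forall K, compact K -> K `<=` D -> polynomial_hull K `<=` D.

End complex_space.

Section plurisubharmonic.
Context {R : realType}.
Local Open Scope ereal_scope.

(* In this section Omega is meant to be open, so that neighbourhoods may be
   taken in the ambient space; values outside Omega are never used. *)

Definition upper_semicontinuous_on {T : topologicalType} (Omega : set T)
    (u : T -> \bar R) :=
  forall x, Omega x -> forall a : R, u x < a%:E ->
    \forall y \near x, u y < a%:E.

(* Subharmonic functions may be identically -oo. *)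
Definition subharmonic (Omega : set R[i]) (u : R[i] -> \bar R) :=
  [/\ upper_semicontinuous_on Omega u,
      forall c, Omega c -> u c < +oo &
      forall c (r : R), (0 < r)%R ->
        [set w | (normc (w - c) <= r)%R] `<=` Omega ->
        u c <= (pi *+ 2)^-1%:E *
          \int[lebesgue_measure]_(t in `[0%R, (pi *+ 2)%R])
            u (c + (r%:C)%C * expi t)%R].

Definition plurisubharmonic {n} (Omega : set 'rV[R[i]]_n)
    (u : 'rV[R[i]]_n -> \bar R) :=
  [/\ upper_semicontinuous_on Omega u,
      forall z, Omega z -> u z < +oo &
      forall a b : 'rV[R[i]]_n,
        subharmonic [set l | Omega (a + l *: b)%R]
                    (fun l => u (a + l *: b)%R)].

End plurisubharmonic.

Section green.
Context {R : realType} {n : nat}.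
Local Open Scope ereal_scope.

Definition pluricomplex_green (D : set 'rV[R[i]]_n) (a z : 'rV[R[i]]_n) :
    \bar R :=
  ereal_sup [set u z | u in [set u : 'rV[R[i]]_n -> \bar R |
    [/\ plurisubharmonic D u,
        forall w, D w -> u w < 0 &
        exists C : R, \forall w \near a^',
          u w <= (ln (enorm (w - a)) + C)%:E]]].

Definition green_at_infinity (K : set 'rV[R[i]]_n) (z : 'rV[R[i]]_n) :
    \bar R :=
  ereal_sup [set u z | u in [set u : 'rV[R[i]]_n -> \bar R |
    [/\ plurisubharmonic setT u,
        forall w, K w -> u w <= 0 &
        exists C : R, forall w, u w <= (ln (1 + enorm w) + C)%:E]]].

(* q^-1 max_k log|P_k|, with value -oo at the common zeros of P *)
Definition log_max (P : 'I_n -> mpoly n R[i]) (q : nat)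
    (z : 'rV[R[i]]_n) : \bar R :=
  (q%:R^-1)%:E * \big[maxe/-oo]_(k < n) lne (normc (peval (P k) z))%:E.

End green.

(* Uniform convergence for the usual distance on the real line.  The library's
   uniform structure on \bar R is that of a bounded metric, hence too coarse
   near -oo.  Since `|x - y| = +oo as soon as x or y is infinite, the functions
   are eventually finite on A. *)
Definition uniform_cvg_on {R : realType} {T : Type} (A : set T)
    (f : nat -> T -> \bar R) (g : T -> \bar R) :=
  forall e : R, 0 < e ->
    \forall s \near \oo, forall z, A z -> (`|f s z - g z| < e%:E)%E.

(* Main.v *)
(* Let h be the Minkowski gauge of D. Both Green functions are explicit: G = ln h
   on D, and max(ln h, 0) is the Green function of the closure. The upper bounds
   follow from the maximum principle on complex lines through 0. For the lower
   bounds one uses the competitors (ln|z^m| - ln sup_D |z^m|) / |m|: by Cauchy's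
   estimates applied to the powers of a polynomial, polynomial convexity of D
   provides for each point outside D a monomial that separates it from a shrunken
   copy of D, and by compactness monomials of one single degree q suffice.

   Hence ln h is, up to a small error, the maximum of finitely many functions
   (<m, x> - c_m) / q in x = (ln|z_1|, ..., ln|z_n|), with |m| = q. To realize it
   with only n polynomials, take n generic perturbations (c_km)_m of c and
   P_k = sum_m exp(- N c_km) z^(N m). The n tropical hypersurfaces where the
   maximum over m is attained twice live in the (n - 1)-dimensional quotient
   R^n / R(1, ..., 1), so by genericity they have no common point, even
   approximately: at every z, some P_k has a dominant monomial, and its modulus
   is the N-th power of the maximum up to a factor between 1/2 and a constant. *)

Require Import Defs.
From mathcomp Require Import all_boot all_order all_algebra.
From mathcomp Require Import finmap complex ring lra zify measurable_realfun.
From mathcomp Require Import all_classical all_reals all_analysis.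
From mathcomp Require Import -(notations) mpoly.

Set Implicit Arguments.
Unset Strict Implicit.
Unset Printing Implicit Defensive.

Import Order.TTheory GRing.Theory Num.Theory numFieldNormedType.Exports.
Import ComplexField.Normc.
Local Open Scope classical_set_scope.
Local Open Scope ring_scope.

(** * Moduli of complex numbers and polydiscs *)

(** Every bound by [ln h] is stated through a parameter [t], separately for [z / t] in [D] and for
    [z / t] outside [D]; homogeneity of monomials carries [t] along. Hence each estimate holds with
    one constant on the whole space, near [0] and near infinity alike, as uniform convergence on
    noncompact sets demands. Genericity is uniform for a similar reason: the linear relation between
    the exponent differences eliminates [x], so the gap is the same at all points, without
    compactness in [x]. It may be tiny, but it is fixed before [N] is chosen, and N-th powers
    magnify it. Both upper bounds meet an unknown additive constant, at the pole or at infinity.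
    Comparison on an annulus with slope [1 - eps] or [1 + eps] in ln|l| absorbs it: as the free
    radius tends to 0 or to infinity, the [eps] term outgrows any constant. The lower bounds need
    ln|z^m| to satisfy the mean value inequality with Lebesgue integrals, even when the circle
    passes through zeros; this is the purpose of the means of ln|a + b e^(it)|. *)

Lemma normc_real (R : rcfType) (x : R) : normc (x%:C)%C = `|x|.
Proof. by rewrite /normc /= expr0n /= addr0 sqrtr_sqr. Qed.

Lemma normc_sub (R : rcfType) (x y : R[i]) : normc (x - y) = normc (y - x).
Proof. by rewrite -normcN opprB. Qed.

Lemma normc_ge0 (R : rcfType) (x : R[i]) : 0 <= normc x.
Proof. by case: x => a b; exact: sqrtr_ge0. Qed.

Lemma normc_normr (R : rcfType) (x : R[i]) : `|x| = ((normc x)%:C)%C.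
Proof. by rewrite normc_def; case: x. Qed.

Lemma normcX (R : rcfType) (x : R[i]) k : normc (x ^+ k) = normc x ^+ k.
Proof. by elim: k => [|k IH]; rewrite ?normc1 // !exprS normcM IH. Qed.

Lemma normc_prod (R : rcfType) (I : Type) (s : seq I) (F : I -> R[i]) :
  normc (\prod_(k <- s) F k) = \prod_(k <- s) normc (F k).
Proof. exact: (big_morph _ (@normcM R) (normc1 R)). Qed.

Lemma le_normc_sum (R : rcfType) (I : Type) (s : seq I) (P : pred I)
    (F : I -> R[i]) :
  normc (\sum_(k <- s | P k) F k) <= \sum_(k <- s | P k) normc (F k).
Proof.
elim/big_ind2 : _ => [|x1 x2 y1 y2 h1 h2|//]; first by rewrite normc0.
by apply: le_trans (le_normcD _ _) _; apply: lerD.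
Qed.

Lemma normc_eq0 (R : rcfType) (x : R[i]) : (normc x == 0) = (x == 0).
Proof.
by apply/eqP/eqP => [/eq0_normc //|->]; rewrite normc0.
Qed.

Lemma normc_gt0 (R : rcfType) (x : R[i]) : (0 < normc x) = (x != 0).
Proof. by rewrite lt_def normc_ge0 andbT normc_eq0. Qed.

Lemma normc_triangle (R : rcfType) (x y z : R[i]) :
  normc (x - z) <= normc (x - y) + normc (y - z).
Proof. by rewrite -(subrKA y); exact: le_normcD. Qed.

Section polydiscs.
Context {R : realType} {n : nat}.
Implicit Types (A : set 'rV[R[i]]_n) (z w : 'rV[R[i]]_n).

(** Balls in [R[i]] have their radii in [R[i]]; a positive radius is real, so radii in [R] give the
    same neighbourhoods. *)
Lemma nbhs_normcP (x : R[i]) (A : set R[i]) :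
  nbhs x A <-> exists2 d : R, 0 < d & forall y, normc (y - x) < d -> A y.
Proof.
split=> [/nbhs_ballP[e /= e0 eA]|[d d0 dA]].
  have er : e \is Num.real by rewrite realE ltW.
  exists (complex.Re e) => [|y yx].
    by rewrite -ltcR (RRe_real er).
  apply: eA; rewrite -ball_normE /= normc_normr -(RRe_real er) ltcR.
  by rewrite normc_sub.
apply/nbhs_ballP; exists (d%:C)%C => /=; first by rewrite ltcR.
move=> y; rewrite -ball_normE /= normc_normr ltcR => yx.
by apply: dA; rewrite normc_sub.
Qed.

Lemma nbhs_polydiscP z A :
  nbhs z A <-> exists2 d : R, 0 < d &
    forall w, (forall k, normc (w ord0 k - z ord0 k) < d) -> A w.
Proof.
split=> [/nbhs_ballP[e /= e0 eA]|[d d0 dA]].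
  have er : e \is Num.real by rewrite realE ltW.
  exists (complex.Re e) => [|y yx].
    by rewrite -ltcR (RRe_real er).
  apply: eA; split=> // i j; rewrite ord1.
  by rewrite -ball_normE /= normc_normr -(RRe_real er) ltcR normc_sub.
apply/nbhs_ballP; exists (d%:C)%C => /=; first by rewrite ltcR.
move=> w [_ zw]; apply: dA => k; have := zw ord0 k.
by rewrite -ball_normE /= normc_normr ltcR normc_sub.
Qed.

Lemma continuous_normc_sub (c : R[i]) : continuous (fun x => normc (x - c)).
Proof.
move=> x A /nbhs_ballP[e /= e0 eA]; apply/nbhs_normcP; exists e => // y yx.
apply: eA; rewrite -ball_normE /= ltr_norml.
have h1 := normc_triangle y x c; have h2 := normc_triangle x y c.
by rewrite (normc_sub x y) in h2; apply/andP; split; lra.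
Qed.

Lemma continuous_normc : continuous (@normc R).
Proof.
rewrite (_ : @normc R = fun x => normc (x - 0)).
  exact: (@continuous_normc_sub 0).
by apply/funext => x; rewrite subr0.
Qed.

Lemma compact_disc (r : R) : compact [set x : R[i] | normc x <= r].
Proof.
set S := (`[- r, r] `*` `[- r, r]).
have cS : compact S by apply: compact_setX; exact: segment_compact.
pose f (p : R * R) : R[i] := (p.1 +i* p.2)%C.
have cf : continuous f.
  move=> p A /nbhs_normcP[d d0 dA].
  apply/nbhs_ballP; exists (d / 2) => /=; first lra.
  move=> q [/= q1 q2]; apply: dA.
  apply: (@le_lt_trans _ _ (`|q.1 - p.1| + `|q.2 - p.2|)).
    have -> : f q - f p = ((q.1 - p.1)%:C)%C + 'i%C * ((q.2 - p.2)%:C)%C.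
      by rewrite /f /=; simpc.
    apply: le_trans (le_normcD _ _) _; rewrite normcM !normc_real.
    by rewrite /normc /= expr0n /= add0r expr1n sqrtr1 mul1r.
  move: q1 q2; rewrite -!ball_normE /= => q1 q2.
  by rewrite (distrC q.1) (distrC q.2); lra.
have /(subclosed_compact _) : compact (f @` S).
  by apply: continuous_compact => //; exact: continuous_subspaceT.
apply.
  have -> : [set x : R[i] | normc x <= r] = @normc R @^-1` [set y | y <= r] by [].
  by apply: closed_comp => [x _|]; [exact: continuous_normc | exact: closed_le].
move=> x /= xr; exists (complex.Re x, complex.Im x); last by case: x {xr}.
have h (a b : R) : `|a| <= Num.sqrt (a ^+ 2 + b ^+ 2).
  rewrite -sqrtr_sqr ler_sqrt ?addr_ge0 ?sqr_ge0 //.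
  by rewrite lerDl sqr_ge0.
case: x xr => a b /= xr; split => /=; rewrite in_itv /= -ler_norml.
  exact: le_trans (h a b) xr.
by apply: le_trans (h b a) _; rewrite addrC.
Qed.

Lemma compact_polydisc (r : 'I_n -> R) A : closed A ->
  (forall z, A z -> forall k, normc (z ord0 k) <= r k) -> compact A.
Proof.
move=> cA Ar.
apply: (subclosed_compact cA
  (@rV_compact _ _ (fun k => [set x | normc x <= r k]) _)) => //.
by move=> k; exact: compact_disc.
Qed.

Lemma continuous_normc_coord k : continuous (fun z => normc (z ord0 k)).
Proof.
move=> z.
apply: (@continuous_comp _ _ _ (fun z : 'rV[R[i]]_n => z ord0 k) (@normc R)).
  exact: coord_continuous.
exact: continuous_normc.
Qed.

Lemma bounded_normc A : bounded_set A ->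
  exists2 B : R, 0 < B & forall z, A z -> forall k, normc (z ord0 k) <= B.
Proof.
move=> [M [Mreal AM]]; have [y My] := complex_realP _ Mreal.
pose B := Num.max y 0 + 1.
have B0 : 0 < B by rewrite ltr_wpDl // le_max lexx orbT.
exists B => // z Az k.
have /= := AM (B%:C)%C _ _ Az; rewrite My ltcR => /(_ _)/wrap[].
  by rewrite (@le_lt_trans _ _ (Num.max y 0)) ?le_max ?lexx // ltrDl.
rewrite [X in X <= _]/Num.norm /= => zB; rewrite -lecR -normc_normr.
apply: le_trans zB; rewrite mx_normE.
rewrite -[leLHS]nngE num_le; exact: (le_bigmax _ _ (ord0, k)).
Qed.
End polydiscs.

(** * Monomials and polynomial hulls of circled sets *)

Section unit_circle.
Context {R : realType}.

Lemma normc_expi (t : R) : normc (expi t) = 1.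
Proof. by rewrite /normc /expi cos2Dsin2 sqrtr1. Qed.

Lemma expiD (s t : R) : expi (s + t) = expi s * expi t.
Proof.
by rewrite /expi cosD sinD; simpc; congr (_ +i* _)%C; ring.
Qed.

Lemma expi0 : expi (0 : R) = 1.
Proof. by rewrite /expi cos0 sin0. Qed.

Lemma expiX (t : R) k : expi t ^+ k = expi (t *+ k).
Proof.
by elim: k => [|k IH]; rewrite ?expi0 // exprS mulrS expiD IH.
Qed.

Lemma expiDpi (t : R) : expi (t + pi) = - expi t.
Proof. by rewrite /expi cosDpi sinDpi; simpc. Qed.

Lemma polar (x : R[i]) : normc x = 1 -> exists t, x = expi t.
Proof.
case: x => a b /= ab1.
have {}ab1 : a ^+ 2 + b ^+ 2 = 1.
  by rewrite -(@sqr_sqrtr _ (a ^+ 2 + b ^+ 2)) ?addr_ge0 ?sqr_ge0 // ab1 expr1n.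
have a1 : -1 <= a <= 1 by apply/andP; split; nra.
have ca : cos (acos a) = a by apply: acosK; rewrite in_itv.
have sa : sin (acos a) = `|b|.
  by rewrite sin_acos // -sqrtr_sqr; congr Num.sqrt; lra.
have [b0|b0] := leP 0 b.
  by exists (acos a); rewrite /expi ca sa ger0_norm.
by exists (- acos a); rewrite /expi cosN sinN ca sa ltr0_norm // opprK.
Qed.

Lemma expi_eq1 (t : R) : 0 < t < pi *+ 2 -> expi t <> 1.
Proof.
move=> /andP[t0 t2] [c1 _].
have : 0 < sin (t / 2) by apply: sin_gt0_pi; rewrite divr_gt0 //=; lra.
have := cos2Dsin2 (t / 2).
have := cos_mulr2n (t / 2).
rewrite -[t / 2 *+ 2]mulr_natr divfK // c1; nra.
Qed.

Lemma prim_root_expi M : (0 < M)%N ->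
  M.-primitive_root (expi (pi *+ 2 / M%:R : R)).
Proof.
move=> M0; rewrite /primitive_root_of_unity M0 /=.
have M0R : (0 : R) < M%:R by rewrite ltr0n.
apply/forallP => -[j jM]; rewrite unity_rootE expiX -[_ *+ j.+1]mulr_natr /=.
have p0 : 0 < pi *+ 2 :> R by have := @pi_gt0 R; lra.
apply/eqP; apply/eqP/eqP => [|->]; last first.
  by rewrite divfK ?gt_eqF // /expi cos2pi sin2pi.
apply: contraPP => /eqP jM'; apply: expi_eq1.
rewrite mulr_gt0 ?divr_gt0 ?ltr0n //=.
rewrite mulrAC ltr_pdivrMr // ltr_pM2l // ltr_nat.
by rewrite ltn_neqAle jM' jM.
Qed.

End unit_circle.

(** The ratio [x ^+ e] of this geometric sum is an [M]-th root of unity, equal to [1] exactly when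
    [M] divides [e]. *)
Lemma sum_prim_root (F : fieldType) M (x : F) e : M.-primitive_root x ->
  \sum_(t < M) x ^+ (t * e) = if (M %| e)%N then M%:R else 0.
Proof.
move=> prx; under eq_bigr do rewrite mulnC exprM.
case: ifPn => [|Me].
  rewrite (prim_order_dvd prx) => /eqP ->.
  by under eq_bigr do rewrite expr1n; rewrite sumr_const card_ord.
apply: (@mulfI _ (x ^+ e - 1)); first by rewrite subr_eq0 -(prim_order_dvd prx).
by rewrite -subrX1 -exprM mulnC exprM (prim_expr_order prx) expr1n subrr mulr0.
Qed.

Section monomials.
Context {R : realType} {n : nat}.
Implicit Types (z w : 'rV[R[i]]_n) (m : multinom n) (p : mpoly n R[i]).

Definition mon m z : R := \prod_(k < n) normc (z ord0 k) ^+ m k.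

Lemma mon_ge0 m z : 0 <= mon m z.
Proof. by apply: prodr_ge0 => k _; rewrite exprn_ge0 ?normc_ge0. Qed.

Lemma normc_mevalX m z : normc (\prod_(k < n) z ord0 k ^+ m k) = mon m z.
Proof. by rewrite normc_prod; apply: eq_bigr => k _; rewrite normcX. Qed.

Lemma monZ m z (t : R[i]) : mon m (t *: z) = normc t ^+ mdeg m * mon m z.
Proof.
rewrite /mon mdegE expr_sum -big_split /=.
by apply: eq_bigr => k _; rewrite mxE normcM exprMn.
Qed.

Lemma monMn m z j : mon (mnm_muln m j) z = mon m z ^+ j.
Proof.
by rewrite -prodrXl; apply: eq_bigr => k _; rewrite mulmnE -exprM.
Qed.

Lemma le_mon m z w : (forall k, normc (w ord0 k) <= normc (z ord0 k)) ->
  mon m w <= mon m z.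
Proof.
move=> wz; apply: ler_prod => k _.
by rewrite exprn_ge0 ?normc_ge0 //= lerXn2r ?nnegrE ?normc_ge0.
Qed.

Lemma pevalE p z :
  peval p z = \sum_(m <- msupp p) mcoeff m p * \prod_k z ord0 k ^+ m k.
Proof. exact: mevalE. Qed.

(* Fourier inversion on the torus, discretized with M-th roots of unity for
   M larger than the degree of p. *)
Lemma cauchy_estimate p z (B : R) m :
  (forall w, (forall k, normc (w ord0 k) = normc (z ord0 k)) ->
    normc (peval p w) <= B) ->
  normc (mcoeff m p) * mon m z <= B.
Proof.
move=> pB.
have B0 : 0 <= B := le_trans (normc_ge0 _) (pB z (fun=> erefl)).
have [mp|mp] := boolP (m \in msupp p); last first.
  by rewrite memN_msupp_eq0 // normc0 mul0r.
pose M := msize p.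
have ltM m' : m' \in msupp p -> forall k, (m' k < M)%N.
  move=> m'p k; apply: leq_ltn_trans (msize_mdeg_lt m'p).
  by rewrite mdegE (bigD1 k) //= leq_addr.
have M0 : (0 < M)%N by apply: leq_ltn_trans (msize_mdeg_lt mp).
have prx := @prim_root_expi R _ M0; set x := expi _ in prx.
(* The exponent [M - m k] stands for [- m k] modulo [M]: [c f] is the conjugate character, which
   isolates the coefficient of [m]. *)
pose c (f : {ffun 'I_n -> 'I_M}) : R[i] := \prod_k x ^+ (f k * (M - m k)).
pose u (f : {ffun 'I_n -> 'I_M}) : 'rV[R[i]]_n :=
  \row_k (x ^+ f k * z ord0 k).
have x1 k : normc (x ^+ k) = 1 by rewrite normcX normc_expi expr1n.
have Mn0 : (0 : R) < (M ^ n)%:R by rewrite ltr0n expn_gt0 M0.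
have key : \sum_f c f * peval p (u f) =
    (M ^ n)%:R * (mcoeff m p * \prod_k z ord0 k ^+ m k).
  under [LHS]eq_bigr do rewrite pevalE mulr_sumr.
  rewrite exchange_big /= (bigD1_seq m) ?msupp_uniq //=.
  have term m' : \sum_f c f * (mcoeff m' p * \prod_k u f ord0 k ^+ m' k) =
     mcoeff m' p * (\prod_k z ord0 k ^+ m' k) *
       \prod_k \sum_(t < M) x ^+ (t * (M - m k + m' k)).
    rewrite bigA_distr_bigA mulr_sumr; apply: eq_bigr => f _ /=.
    rewrite mulrCA -!mulrA; congr (_ * _).
    rewrite -!big_split /=; apply: eq_bigr => k _.
    by rewrite mxE exprMn -exprM mulnDr exprD [RHS]mulrC mulrA.
  rewrite term [X in _ + X]big1_seq ?addr0 => [|m' /andP[m'm m'p]].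
    rewrite mulrC; congr (_ * _).
    rewrite (eq_bigr (fun=> M%:R)) ?prodr_const ?card_ord ?natrX // => k _.
    by rewrite subnK ?(ltnW (ltM _ mp _)) // sum_prim_root // dvdnn.
  rewrite term; apply/eqP; rewrite mulf_eq0; apply/orP; right.
  have /existsP[k mk] : [exists k, m' k != m k].
    apply: contraNT m'm => /existsPn h; apply/eqP/mnmP => k.
    by have /negPn/eqP := h k.
  rewrite (bigD1 k) //= sum_prim_root // ifN ?mul0r //.
  (* As [m k] and [m' k] are below [M], the exponent [M - m k + m' k] lies strictly between [0] and
     [2 * M]; a multiple of [M] there can only be [M], which forces [m' k = m k]. *)
  have := ltM _ m'p k; have := ltM _ mp k => hm hm'.
  apply/negP => /dvdnP[[|[|j]]]; rewrite ?mul0n ?mul1n; first lia.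
    by move=> h; move/eqP: mk; lia.
  by rewrite !mulSn; lia.
have : normc (\sum_f c f * peval p (u f)) <= (M ^ n)%:R * B.
  apply: le_trans (le_normc_sum _ _ _) _.
  apply: le_trans (_ : \sum_(f : {ffun 'I_n -> 'I_M}) B <= _).
    apply: ler_sum => f _; rewrite normcM normc_prod big1 ?mul1r => [|k _].
      by apply: pB => k; rewrite mxE normcM x1 mul1r.
    exact: x1.
  by rewrite sumr_const card_ffun !card_ord mulr_natl.
rewrite key normcM normcM normc_mevalX.
have -> : normc ((M ^ n)%:R : R[i]) = (M ^ n)%:R.
  by rewrite -(rmorph_nat (@real_complex R)) normc_real ger0_norm // ltW.
by rewrite ler_pM2l.
Qed.

Lemma size_msupp p : (size (msupp p) <= msize p ^ n)%N.
Proof.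
case E : (msize p) => [|d].
  move/eqP: E; rewrite msize_poly_eq0 => /eqP ->.
  by rewrite msupp0.
pose f m : {ffun 'I_n -> 'I_d.+1} := [ffun k => inord (m k)].
have le m : m \in msupp p -> forall k, (m k < d.+1)%N.
  move=> mp k; rewrite -E; apply: leq_ltn_trans (msize_mdeg_lt mp).
  by rewrite mdegE (bigD1 k) //= leq_addr.
have -> : (d.+1 ^ n = #|{: {ffun 'I_n -> 'I_d.+1}}|)%N.
  by rewrite card_ffun !card_ord.
rewrite -(size_map f) cardE; apply: uniq_leq_size => [|x _].
  rewrite map_inj_in_uniq ?msupp_uniq // => m1 m2 /le h1 /le h2 /ffunP h.
  apply/mnmP => k; have := h k; rewrite !ffunE => /(congr1 val) /=.
  by rewrite !inordK.
by rewrite mem_enum.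
Qed.

Lemma msizeX p j : (msize (p ^+ j) <= j * (msize p).+1 + 1)%N.
Proof.
elim: j => [|j IH]; first by rewrite expr0 msize1.
rewrite exprS; apply: leq_trans (msizeM_le _ _) _.
by rewrite mulSn; lia.
Qed.

Lemma pevalX p z j : peval (p ^+ j) z = peval p z ^+ j.
Proof. exact: rmorphXn. Qed.

End monomials.

Lemma bernoulli (R : realDomainType) (x : R) j :
  1 <= x -> j%:R * (x - 1) <= x ^+ j.
Proof.
move=> x1; elim: j => [|j IH]; first by rewrite mul0r.
rewrite exprS -natr1 mulrDl mul1r.
have := exprn_ege1 j x1; nra.
Qed.

(** A factor of polynomial growth in [j] disappears in the limit of [j]-th roots. *)
Lemma exp_le_poly (R : archiRealFieldType) (x B : R) d n : 0 <= B ->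
  (forall j, x ^+ j <= ((j * d + 1) ^ n)%:R * B ^+ j) -> x <= B.
Proof.
move=> B0 xB; rewrite leNgt; apply/negP => Bx.
have [B0'|B0'] := eqVneq B 0.
  have := xB 1%N; rewrite B0' expr1 expr0n mulr0.
  by rewrite leNgt -B0' Bx.
have {B0 B0'} B0 : 0 < B by rewrite lt_def B0' B0.
pose r := x / B.
have r1 : 1 < r by rewrite ltr_pdivlMr // mul1r.
have rle j : r ^+ j <= ((j * d + 1) ^ n)%:R.
  by rewrite expr_div_n ler_pdivrMr ?exprn_gt0.
(* With exponent [j.+1 * n.+1], Bernoulli's inequality gives growth of degree [n + 1] in [j.+1],
   against degree [n] on the right; dividing by the [n]-th power leaves an unbounded left side. *)
have {}rle j : j.+1%:R * (r - 1) ^+ n.+1 <= (((n.+1 * d + 1)) ^ n)%:R.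
  have h : (j.+1%:R * (r - 1)) ^+ n.+1 <= ((j.+1 * n.+1 * d + 1) ^ n)%:R.
    apply: le_trans (rle (j.+1 * n.+1)%N); rewrite exprM lerXn2r ?nnegrE //.
    - by rewrite mulr_ge0 // subr_ge0 ltW.
    - by rewrite exprn_ge0 // (le_trans _ (ltW r1)).
    - by apply: bernoulli; exact: ltW.
  have j0 : (0 : R) < j.+1%:R ^+ n by rewrite exprn_gt0.
  rewrite -(ler_pM2l j0) mulrA -exprSr -exprMn; apply: le_trans h _.
  rewrite !natrX -exprMn lerXn2r ?nnegrE ?mulr_ge0 //.
  by rewrite -natrM ler_nat; lia.
set C := (((n.+1 * d + 1) ^ n)%:R : R) in rle.
have e0 : 0 < (r - 1) ^+ n.+1 by rewrite exprn_gt0 // subr_gt0.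
have C0 : 0 <= C / (r - 1) ^+ n.+1 by rewrite divr_ge0 // ltW.
have := rle (Num.bound (C / (r - 1) ^+ n.+1)).
rewrite -ler_pdivlMr // leNgt; apply/negP/negPn.
by apply: lt_trans (archi_boundP C0) _; rewrite ltr_nat.
Qed.

(** Cauchy's estimates for [p] itself would lose a factor, its number of monomials. For [p ^+ j]
    that number is polynomial in [j], so the loss vanishes after a [j]-th root, and monomials alone
    decide the hull of a circled set. *)
Lemma circled_hull (R : realType) n (K : set 'rV[R[i]]_n) w :
  (forall z, K z -> forall v : 'rV[R[i]]_n,
     (forall k, normc (v ord0 k) = normc (z ord0 k)) -> K v) ->
  (forall m, exists2 z, K z & mon m w <= mon m z) ->
  forall p B, (forall z, K z -> normc (peval p z) <= B) ->
  normc (peval p w) <= B.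
Proof.
move=> circK wK p B pB.
have B0 : 0 <= B.
  by have [z Kz _] := wK (mnm0 (n:=n)); exact: le_trans (normc_ge0 _) (pB z Kz).
apply: (@exp_le_poly _ _ _ (msize p).+1 n) => // j.
rewrite -normcX -pevalX pevalE.
apply: le_trans (le_normc_sum _ _ _) _.
apply: le_trans (_ : \sum_(m <- msupp (p ^+ j)) B ^+ j <= _).
  apply: ler_sum => m _; rewrite normcM normc_mevalX.
  have [z Kz wz] := wK m.
  apply: le_trans (_ : normc (mcoeff m (p ^+ j)) * mon m z <= _).
    by rewrite ler_wpM2l ?normc_ge0.
  apply: cauchy_estimate => v vz; rewrite pevalX normcX.
  by rewrite lerXn2r ?nnegrE ?normc_ge0 // pB //; exact: circK vz.
rewrite big_const_seq count_predT iter_addr_0 -[leLHS]mulr_natl.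
rewrite ler_wpM2r ?exprn_ge0 // ler_nat.
apply: leq_trans (size_msupp _) _.
suff lexp a b k : (a <= b)%N -> (a ^ k <= b ^ k)%N by exact/lexp/msizeX.
by case: k => // k; rewrite leq_exp2r.
Qed.

(** * Polynomially convex Reinhardt domains *)

Lemma finite_pos_lb (R : realDomainType) (I : finType) (F : I -> R) :
  (forall i, 0 < F i) -> exists2 e, 0 < e & forall i, e <= F i.
Proof.
move=> F0; exists (\big[Num.min/1]_i F i); last by move=> i; exact: bigmin_le_cond.
by apply: lt_bigmin => [|i _]; rewrite ?ltr01 ?F0.
Qed.

Lemma compact_circle (R : realType) (r : R) : compact [set x : R[i] | normc x = r].
Proof.
have cl : closed [set x : R[i] | normc x = r].
  have -> : [set x : R[i] | normc x = r] = @normc R @^-1` [set y | y = r] by [].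
  by apply: closed_comp => [x _|]; [exact: continuous_normc | exact: closed_eq].
apply: (subclosed_compact cl (@compact_disc _ r)).
by move=> x /= ->.
Qed.

Section reinhardt_domains.
Context {R : realType} {n : nat} (D : set 'rV[R[i]]_n).
Hypothesis D_domain : domain D.
Hypothesis D_bounded : bounded_set D.
Hypothesis D_polyconvex : polynomially_convex D.
Hypothesis D_reinhardt : reinhardt D.
Implicit Types (z w : 'rV[R[i]]_n) (m : multinom n).

Lemma continuous_mon m : continuous (@mon R n m).
Proof.
apply: continuous_big => [|k _]; first exact: mul_continuous.
move=> z; apply: (@continuous_comp _ _ _ (fun z : 'rV[R[i]]_n => normc (z ord0 k))
  (fun x : R => x ^+ m k)); first exact: continuous_normc_coord.
exact: exprn_continuous.
Qed.

Lemma reinhardt_circled z w : D z ->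
  (forall k, normc (w ord0 k) = normc (z ord0 k)) -> D w.
Proof.
move=> Dz wz.
suff [phi ->] : exists phi, w = \row_k (expi (phi k) * z ord0 k).
  exact: D_reinhardt.
have /choice[phi phiE] k : exists t, w ord0 k = expi t * z ord0 k.
  have [z0|z0] := eqVneq (z ord0 k) 0.
    exists 0; rewrite z0 mulr0; apply/eqP.
    by rewrite -normc_eq0 wz z0 normc0.
  have [|t ht] := @polar _ (w ord0 k / z ord0 k).
    by rewrite normcM normcV wz divff // normc_eq0.
  by exists t; rewrite -ht divfK.
by exists phi; apply/rowP => k; rewrite mxE.
Qed.

Lemma circled_closure z w : closure D z ->
  (forall k, normc (w ord0 k) = normc (z ord0 k)) -> closure D w.
Proof.
move=> Dz wz A /nbhs_polydiscP[d d0 dA].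
have /choice[u uP] k : exists t, w ord0 k = t * z ord0 k /\ normc t = 1.
  have [z0|z0] := eqVneq (z ord0 k) 0.
    exists 1; split; last exact: normc1.
    by rewrite z0 mulr0; apply/eqP; rewrite -normc_eq0 wz z0 normc0.
  exists (w ord0 k / z ord0 k); rewrite divfK //.
  by rewrite normcM normcV wz divff // normc_eq0.
have [|v [Dv vz]] := Dz [set v | forall k, normc (v ord0 k - z ord0 k) < d].
  by apply/nbhs_polydiscP; exists d.
exists (\row_k (u k * v ord0 k)); split.
  by apply: reinhardt_circled Dv _ => k; rewrite mxE normcM (uP k).2 mul1r.
apply: dA => k; rewrite mxE (uP k).1 -mulrBr normcM (uP k).2 mul1r.
exact: vz.
Qed.

Lemma circled_hull_sub (K : set 'rV[R[i]]_n) w : compact K -> K `<=` D ->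
  (forall z, K z -> forall v : 'rV[R[i]]_n,
     (forall k, normc (v ord0 k) = normc (z ord0 k)) -> K v) ->
  (forall m, exists2 z, K z & mon m w <= mon m z) -> D w.
Proof.
move=> cK KD circK wK; apply: (D_polyconvex cK KD) => p.
apply: (circled_hull circK wK) => z Kz.
(* [sup] is meaningful only for sets bounded above, so [p] is first bounded on [K] term by term,
   from the boundedness of [D]. *)
apply: ub_le_sup; last by exists z.
have [B B0 DB] := bounded_normc D_bounded.
exists (\sum_(m <- msupp p) normc (mcoeff m p) * \prod_(k < n) B ^+ m k).
move=> _ [v Kv <-]; rewrite pevalE.
apply: le_trans (le_normc_sum _ _ _) _; apply: ler_sum => m _.
rewrite normcM normc_mevalX ler_wpM2l ?normc_ge0 //.
apply: ler_prod => k _; rewrite exprn_ge0 ?normc_ge0 //=.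
by rewrite lerXn2r ?nnegrE ?normc_ge0 ?(ltW B0) //; exact/DB/KD.
Qed.

(** Each monomial has constant modulus [mon m z] on the torus [K] through [z], so the hull of [K]
    contains the closed polydisc that [K] bounds. *)
Lemma reinhardt_complete z w : D z ->
  (forall k, normc (w ord0 k) <= normc (z ord0 k)) -> D w.
Proof.
move=> Dz wz.
pose K := [set v : 'rV[R[i]]_n | forall k, normc (v ord0 k) = normc (z ord0 k)].
apply: (@circled_hull_sub K).
- apply: (@rV_compact _ _ (fun k => [set x | normc x = normc (z ord0 k)])) => k.
  exact: compact_circle.
- by move=> v; exact: reinhardt_circled.
- by move=> v Kv y yv k; rewrite yv Kv.
- by move=> m; exists z => //; exact: le_mon.
Qed.

Lemma domain0 : D 0.
Proof.
have [_ _ [z Dz]] := D_domain; apply: (reinhardt_complete Dz) => k.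
by rewrite mxE normc0 normc_ge0.
Qed.

(** Points of [D] close to [z] dominate [t *: z] in every coordinate, and completeness applies;
    coordinates where [z] vanishes impose no condition. *)
Lemma closure_scale z (t : R[i]) : closure D z -> normc t < 1 -> D (t *: z).
Proof.
move=> Dz t1.
have /choice[d dP] k : exists d : R, 0 < d /\ forall x,
    normc (x - z ord0 k) < d -> normc (t * z ord0 k) <= normc x.
  have [z0|z0] := eqVneq (z ord0 k) 0.
    by exists 1; split=> // x _; rewrite z0 mulr0 normc0 normc_ge0.
  exists ((1 - normc t) * normc (z ord0 k)); split.
    by rewrite mulr_gt0 ?normc_gt0 // subr_gt0.
  move=> x; rewrite normcM mulrBl mul1r => h.
  have := normc_triangle (z ord0 k) x 0; rewrite !subr0 normc_sub; lra.
have [e e0 ed] := finite_pos_lb (fun k => (dP k).1).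
have [|v [Dv vz]] := Dz [set v | forall k, normc (v ord0 k - z ord0 k) < e].
  by apply/nbhs_polydiscP; exists e.
apply: (reinhardt_complete Dv) => k; rewrite mxE; apply: (dP k).2.
exact: lt_le_trans (vz k) (ed k).
Qed.

Lemma polydisc_sub : exists2 d : R, 0 < d &
  forall w, (forall k, normc (w ord0 k) < d) -> D w.
Proof.
have [oD _ _] := D_domain.
have /nbhs_polydiscP[d d0 dD] : nbhs (0 : 'rV[R[i]]_n) D.
  by apply: open_nbhs_nbhs; split=> //; exact: domain0.
exists d => // w wd; apply: dD => k; rewrite mxE subr0; exact: wd.
Qed.

Definition supmon m : R := sup [set mon m z | z in D].

Lemma le_supmon_D m z : D z -> mon m z <= supmon m.
Proof.
move=> Dz; apply: ub_le_sup; last by exists z.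
have [B B0 DB] := bounded_normc D_bounded.
exists (\prod_(k < n) B ^+ m k) => _ [v Dv <-].
apply: ler_prod => k _; rewrite exprn_ge0 ?normc_ge0 //=.
by rewrite lerXn2r ?nnegrE ?normc_ge0 ?(ltW B0) //; exact/DB.
Qed.

Lemma supmon_le m (B : R) : (forall z, D z -> mon m z <= B) -> supmon m <= B.
Proof.
move=> DB; apply: ge_sup; last by move=> _ [z Dz <-]; exact: DB.
by exists (mon m (0 : 'rV[R[i]]_n)), 0 => //; exact: domain0.
Qed.

Lemma le_supmon m z : closure D z -> mon m z <= supmon m.
Proof.
move=> Dz.
have cl : closed [set v : 'rV[R[i]]_n | mon m v <= supmon m].
  have -> : [set v : 'rV[R[i]]_n | mon m v <= supmon m] =
    mon m @^-1` [set y | y <= supmon m] by [].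
  by apply: closed_comp => [x _|]; [exact: continuous_mon | exact: closed_le].
by apply: cl; move: z Dz; apply: closure_subset => v /(le_supmon_D m).
Qed.

Lemma supmon_gt0 m : 0 < supmon m.
Proof.
have [d d0 dD] := polydisc_sub.
pose z : 'rV[R[i]]_n := const_mx ((d / 2)%:C)%C.
have zk k : normc (z ord0 k) = d / 2.
  by rewrite mxE normc_real ger0_norm //; lra.
apply: lt_le_trans (le_supmon_D m (_ : D z)); last first.
  by apply: dD => k; rewrite zk; lra.
by apply: prodr_gt0 => k _; rewrite zk exprn_gt0 //; lra.
Qed.

(** For [r < s < 1] the set [K], which is [closure D] scaled by [s], is compact, circled and inside
    [D], so some monomial separates [w] from it. It is not constant because [0] is in [K]. The slack
    between [r] and [s] makes the inequality strict, hence open in [w]. *)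
Lemma exists_monomial w (r : R) : 0 < r < 1 -> ~ D w ->
  exists2 m, (0 < mdeg m)%N & r ^+ mdeg m * supmon m < mon m w.
Proof.
move=> /andP[r0 r1] Dw.
have [s /andP[rs s1]] : exists s : R, r < s < 1.
  by exists ((r + 1) / 2); apply/andP; split; lra.
have s0 : 0 < s by lra.
have normcs : normc (s%:C)%C = s by rewrite normc_real gtr0_norm.
pose K := [set (s%:C)%C *: z | z in closure D].
have cK : compact K.
  apply: continuous_compact.
    by apply: continuous_subspaceT; exact: scaler_continuous.
  have [B B0 DB] := bounded_normc D_bounded.
  apply: (@compact_polydisc _ _ (fun=> B)) => [|z Dz k]; first exact: closed_closure.
  have cl : closed [set v : 'rV[R[i]]_n | normc (v ord0 k) <= B].
    have -> : [set v : 'rV[R[i]]_n | normc (v ord0 k) <= B] =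
      (fun v => normc (v ord0 k)) @^-1` [set y | y <= B] by [].
    by apply: closed_comp => [x _|];
      [exact: continuous_normc_coord | exact: closed_le].
  by apply: cl; move: z Dz; apply: closure_subset => v /DB /(_ k).
have KD : K `<=` D.
  by move=> _ [z Dz <-]; apply: closure_scale => //; rewrite normcs.
have circK z : K z -> forall v : 'rV[R[i]]_n,
    (forall k, normc (v ord0 k) = normc (z ord0 k)) -> K v.
  move=> [u Du <-] v vu; exists ((s^-1%:C)%C *: v); last first.
    by rewrite scalerA -rmorphM /= divff ?gt_eqF // scale1r.
  apply: (circled_closure Du) => k; rewrite mxE normcM vu mxE normcM mulrA.
  by rewrite -normcM -rmorphM mulVf ?gt_eqF // normc1 mul1r.
have [m mP] : exists m, forall z, K z -> mon m z < mon m w.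
  apply: contra_notP Dw => /forallNP h.
  apply: (circled_hull_sub cK KD circK) => m.
  have /existsNP[z /not_implyP[Kz /negP]] := h m.
  by rewrite -leNgt; exists z.
have K0 : K 0.
  by exists 0; [exact/subset_closure/domain0 | rewrite scaler0].
have m0 : (0 < mdeg m)%N.
  rewrite lt0n; apply/eqP => m0; have := mP 0 K0.
  have mk k : m k = 0%N.
    by apply/eqP; rewrite -leqn0 -m0 mdegE (bigD1 k) //= leq_addr.
  by rewrite /mon !big1 ?ltxx // => k _; rewrite mk expr0.
exists m => //.
apply: lt_le_trans (_ : s ^+ mdeg m * supmon m <= _).
  by rewrite ltr_pM2r ?supmon_gt0 // ltrXn2r ?nnegrE ?ltW // -lt0n.
rewrite mulrC -ler_pdivlMr ?exprn_gt0 //; apply: supmon_le => z Dz.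
rewrite ler_pdivlMr ?exprn_gt0 // mulrC.
have := mP ((s%:C)%C *: z); rewrite monZ normcs => /(_ _)/ltW; apply.
by exists z => //; exact: subset_closure.
Qed.

Lemma supmonMn m j : supmon (mnm_muln m j) <= supmon m ^+ j.
Proof.
apply: supmon_le => z Dz; rewrite monMn lerXn2r ?nnegrE ?mon_ge0 //.
  exact: ltW (supmon_gt0 m).
exact: le_supmon_D.
Qed.

(** Powers of a monomial inherit its inequality by [supmonMn], so the finitely many monomials of a
    subcover can be raised to a common degree, the product of their degrees. *)
Lemma uniform_monomials (r : R) : 0 < r < 1 ->
  exists2 q, (0 < q)%N & forall (t : R) w, 0 < t -> ~ D ((t^-1%:C)%C *: w) ->
    exists2 m, mdeg m = q & (r * t) ^+ q * supmon m <= mon m w.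
Proof.
move=> r01; have /andP[r0 r1] := r01.
have [oD _ _] := D_domain.
have [B B0 DB] := bounded_normc D_bounded.
(* The complement of [D] is cut off at radius [B + 1], strictly beyond the bound [B] of [D], to
   become compact. *)
pose C := [set w : 'rV[R[i]]_n | forall k, normc (w ord0 k) <= B + 1] `&` ~` D.
have cC : compact C.
  apply: (@compact_polydisc _ _ (fun=> B + 1)) => [|w [] //].
  apply: closedI; last exact: open_closedC.
    have -> : [set w : 'rV[R[i]]_n | forall k, normc (w ord0 k) <= B + 1] =
        \bigcap_(k in setT) [set w : 'rV[R[i]]_n | normc (w ord0 k) <= B + 1].
      by apply/seteqP; split => [w h k _|w h k]; [exact: h | exact: (h k)].
    apply: closed_bigI => k _.
    have -> : [set v : 'rV[R[i]]_n | normc (v ord0 k) <= B + 1] =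
      (fun v => normc (v ord0 k)) @^-1` [set y | y <= B + 1] by [].
    by apply: closed_comp => [x _|];
      [exact: continuous_normc_coord | exact: closed_le].
pose U m := [set w : 'rV[R[i]]_n | r ^+ mdeg m * supmon m < mon m w].
have : finite_subset_cover [set m : multinom n | (0 < mdeg m)%N] U C.
  move: cC; rewrite compact_cover; apply.
    move=> m _.
    have -> : U m = mon m @^-1` [set y | r ^+ mdeg m * supmon m < y] by [].
    by apply: open_comp => [x _|]; [exact: continuous_mon | exact: open_gt].
  by move=> w [_ Dw]; have [m] := exists_monomial r01 Dw; exists m.
move=> [F F0 CF].
pose q := (\prod_(m <- F) mdeg m)%N.
have q0 : (0 < q)%N.
  rewrite /q big_seq_cond prodn_cond_gt0 // => m /andP[mF _].
  by have := F0 _ mF; rewrite inE.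
have main w : C w -> exists2 m, mdeg m = q & r ^+ q * supmon m <= mon m w.
  move=> /CF[m /= mF Um].
  have mq : (mdeg m %| q)%N by rewrite /q (big_rem _ mF) /= dvdn_mulr.
  exists (mnm_muln m (q %/ mdeg m)); first by rewrite mdegMn mulnC divnK.
  rewrite monMn -{1}(divnK mq) mulnC exprM.
  apply: le_trans (_ : (r ^+ mdeg m * supmon m) ^+ (q %/ mdeg m) <= _).
    rewrite exprMn ler_wpM2l ?supmonMn // !exprn_ge0 //; exact: ltW.
  rewrite lerXn2r ?nnegrE ?mon_ge0 ?(ltW Um) // mulr_ge0 //.
    by rewrite exprn_ge0 // ltW.
  by rewrite ltW // supmon_gt0.
exists q => // t w t0 Dw.
suff [m mq h] : exists2 m, mdeg m = q &
    r ^+ q * supmon m <= mon m ((t^-1%:C)%C *: w).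
  exists m => //; move: h; rewrite monZ mq normc_real ger0_norm ?invr_ge0 ?(ltW t0) //.
  by rewrite exprVn ler_pdivlMl ?exprn_gt0 // exprMn mulrA (mulrC (t ^+ _)).
move: {w t0} (_ *: w) Dw => w Dw.
(* A point beyond radius [B + 1] is shrunk until its largest coordinate has modulus [B + 1]. It
   stays outside [D], whose coordinates are at most [B], and shrinking only lowers monomials. If
   [a = B + 1], nothing moves. *)
pose a := \big[Num.max/B + 1]_k normc (w ord0 k).
have aB : B + 1 <= a by exact: bigmax_ge_id.
have a0 : 0 < a by lra.
have wa k : normc (w ord0 k) <= a by exact: le_bigmax.
have normcs : normc (((B + 1) / a)%:C)%C = (B + 1) / a.
  by rewrite normc_real ger0_norm // divr_ge0 ?ltW //; lra.
pose v := (((B + 1) / a)%:C)%C *: w.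
have vk k : normc (v ord0 k) = (B + 1) / a * normc (w ord0 k).
  by rewrite mxE normcM normcs.
have [|m mq mv] := main v.
  split=> [k|].
    by rewrite vk mulrAC ler_pdivrMr // ler_wpM2l //; lra.
  move=> Dv; apply: Dw.
  suff -> : w = v by [].
  have [aE|/eqP aE] := eqVneq a (B + 1).
    by rewrite /v aE divff ?scale1r //; apply/eqP; lra.
  exfalso.
  have : (a == B + 1) || [exists k, a == normc (w ord0 k)].
    rewrite /a; elim/big_ind : _ => [|x y hx hy|k _]; first by rewrite eqxx.
      by have [|] := leP x y.
    by apply/orP; right; apply/existsP; exists k.
  move=> /orP[/eqP //|/existsP[k /eqP ak]].
  have := DB _ Dv k; rewrite vk -ak divfK ?gt_eqF //; lra.
exists m => //; apply: le_trans mv _; apply: le_mon => k.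
rewrite vk ler_piMl ?normc_ge0 // ler_pdivrMr // mul1r; exact: aB.
Qed.

End reinhardt_domains.

(** * Generic tropical polynomials *)

(** There are [size p] candidates [1 / (j + 2)], more than [p] has roots. *)
Lemma exists_nonroot (R : numFieldType) (p : {poly R}) : p != 0 ->
  exists2 t, 0 < t < 1 & p.[t] != 0.
Proof.
move=> p0; pose s := [seq (j.+2%:R : R)^-1 | j <- iota 0 (size p)].
have us : uniq s.
  rewrite map_inj_uniq ?iota_uniq // => i j /invr_inj/eqP.
  by rewrite eqr_nat => /eqP[].
have : ~~ all (root p) s.
  apply/negP => /(max_poly_roots p0)/(_ us).
  by rewrite size_map size_iota ltnn.
move=> /allPn[t /mapP[j _ ->] nr]; exists (j.+2%:R^-1) => //.
by rewrite invr_gt0 ltr0n /= invf_lt1 ?ltr0n // ltr1n.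
Qed.

(* n tropical hypersurfaces in the quotient of R^n by the line (1, ..., 1)
   have no common point when their coefficients are generic: the n exponent
   differences that witness ties are linearly dependent, whereas the same
   combination of coefficient differences is nonzero. *)
Lemma generic_unique_max (R : realFieldType) (n : nat) (I : finType)
    (a : I -> 'I_n -> R) (b : R) (c0 : I -> R) (d : R) : (0 < n)%N ->
  (forall i, \sum_k a i k = b) -> 0 < d ->
  exists2 c : 'I_n -> I -> R, forall k i, c0 i <= c k i <= c0 i + d &
  exists2 e, 0 < e & forall (x : 'I_n -> R) (T : pred I) i0, T i0 ->
    exists k, exists2 i, T i & forall j, T j -> j != i ->
      \sum_l a j l * x l - c k j <= \sum_l a i l * x l - c k i - e.
Proof.
move=> n0 ab d0.
pose A (tau : {ffun 'I_n -> I * I}) : 'M[R]_n :=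
  \matrix_(k, l) (a (tau k).1 l - a (tau k).2 l).
(* The rows of [A tau] sum to [b - b = 0], so the matrix kills the all-ones vector and is singular;
   [lam tau] is a dependence between its rows. *)
have /choice[lam lamP] tau : exists v : 'rV[R]_n, v != 0 /\ v *m A tau = 0.
  suff /eqP/det0P[v v0 vA] : \det (A tau) = 0 by exists v.
  rewrite -det_tr; apply/eqP/det0P; exists (const_mx 1).
    by apply/eqP => /rowP/(_ (Ordinal n0))/eqP; rewrite !mxE oner_eq0.
  apply/rowP => k; rewrite !mxE (eq_bigr (fun l => a (tau k).1 l - a (tau k).2 l)).
    by rewrite sumrB !ab subrr.
  by move=> l _; rewrite !mxE mul1r.
(* Each pair [(k, i)] gets its own power of a single parameter [t], which reduces genericity to
   avoiding roots of polynomials in one variable. The successor keeps these powers apart from the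
   constant term that comes from [c0]. *)
pose id (k : 'I_n) (i : I) : nat := (enum_rank (k, i)).+1.
have id_inj k i k' i' : (id k i == id k' i') = (k == k') && (i == i').
  rewrite /id eqSS (inj_eq val_inj) (inj_eq enum_rank_inj).
  by rewrite xpair_eqE.
pose pol (tau : {ffun 'I_n -> I * I}) : {poly R} := \sum_k lam tau ord0 k *:
  ((c0 (tau k).1 - c0 (tau k).2)%:P
    + d *: ('X^(id k (tau k).1) - 'X^(id k (tau k).2))).
pose good (tau : {ffun 'I_n -> I * I}) := [forall k, (tau k).1 != (tau k).2].
have pol_neq0 tau : good tau -> pol tau != 0.
  move=> /forallP gt; have [/rV0Pn[k0 lk0] _] := lamP tau.
  apply: contraNneq lk0 => pt0.
  have := congr1 (fun p : {poly R} => p`_(id k0 (tau k0).1)) pt0.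
  rewrite coef0 /pol coef_sum (bigD1 k0) //= big1 ?addr0 => [|k kk0].
    rewrite coefZ coefD coefC coefZ coefB !coefXn /= !id_inj !eqxx /=.
    rewrite (negPf (gt k0)) subr0 mulr1 add0r => /eqP.
    by rewrite mulf_eq0 (gt_eqF d0) orbF.
  rewrite coefZ coefD coefC coefZ coefB !coefXn /= !id_inj.
  by rewrite eq_sym (negPf kk0) /= subrr mulr0 addr0 mulr0.
have [|t /andP[t0 t1] tP] := @exists_nonroot R (\prod_(tau | good tau) pol tau).
  by apply/prodf_neq0.
pose c k i := c0 i + d * t ^+ id k i.
have polE tau : (pol tau).[t] =
    \sum_k lam tau ord0 k * (c k (tau k).1 - c k (tau k).2).
  rewrite horner_sum; apply: eq_bigr => k _.
  by rewrite !hornerE /c; ring.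
exists c => [k i|].
  rewrite /c lerDl lerD2l mulr_ge0 ?exprn_ge0 ?(ltW t0) ?(ltW d0) //=.
  by rewrite ler_piMr ?exprn_ile1 ?(ltW t0) ?(ltW t1) ?(ltW d0).
have S0 tau : 0 < 1 + \sum_k `|lam tau ord0 k|.
  by rewrite ltr_wpDr // sumr_ge0.
(* The added [1] keeps the denominator positive and makes [e] times the sum of the [|lam|] strictly
   less than [|(pol tau).[t]|]; families [tau] that are not [good] get an irrelevant value. *)
have [|e e0 eP] := @finite_pos_lb R _ (fun tau => if good tau
    then `|(pol tau).[t]| / (1 + \sum_k `|lam tau ord0 k|) else 1).
  move=> tau; case: ifP => // gt; rewrite divr_gt0 // normr_gt0.
  by move: tP; rewrite horner_prod => /prodf_neq0; apply.
(* Otherwise every [k] has a tie up to [e] between two distinct indices, and these pairs form a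
   [good] family [tau]. *)
exists e => // x T i0 Ti0; apply: contrapT => /forallNP noK.
pose L k i := \sum_l a i l * x l - c k i.
have /choice[tau0 tauP] k : exists ij : I * I,
    ij.1 != ij.2 /\ `|L k ij.1 - L k ij.2| <= e.
  pose i := [arg max_(i > i0 | T i) L k i]%O.
  have [Ti iP] : T i /\ forall j, T j -> L k j <= L k i.
    by rewrite /i; case: arg_maxP => // j Tj jP; split.
  have := noK k => /forall2NP/(_ i)[//|/existsNP[j /not_implyP[Tj]]].
  move=> /not_implyP[ji /negP]; rewrite -ltNge => h.
  exists (i, j); split; first by rewrite eq_sym.
  have := iP j Tj; rewrite /= /L => h2; rewrite ger0_norm ?subr_ge0 //; lra.
pose tau : {ffun 'I_n -> I * I} := [ffun k => tau0 k].
have gt : good tau by apply/forallP => k; rewrite ffunE (tauP k).1.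
have := eP tau; rewrite gt ler_pdivlMr //; apply/negP; rewrite -ltNge.
apply: (@le_lt_trans _ _ (e * \sum_k `|lam tau ord0 k|)); last first.
  by rewrite ltr_pM2l // ltrDr.
(* The combination [lam tau] cancels all terms in [x]; only coefficient differences remain, so near
   ties would make [(pol tau).[t]] too small. *)
have -> : (pol tau).[t] =
    - \sum_k lam tau ord0 k * (L k (tau k).1 - L k (tau k).2).
  have lamA : \sum_k lam tau ord0 k *
      (\sum_l a (tau k).1 l * x l - \sum_l a (tau k).2 l * x l) = 0.
    have [_ vA] := lamP tau.
    under eq_bigr do rewrite -sumrB mulr_sumr.
    rewrite exchange_big /= big1 // => l _.
    have := congr1 (fun v : 'rV_n => v ord0 l * x l) vA.
    rewrite !mxE mul0r mulr_suml => vA0; rewrite -[RHS]vA0.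
    by apply: eq_bigr => k _; rewrite mxE; ring.
  rewrite polE; apply/eqP; rewrite -addr_eq0 -big_split /= -[eqbRHS]lamA.
  by apply/eqP/eq_bigr => k _; rewrite /L; ring.
rewrite normrN mulr_sumr; apply: le_trans (ler_norm_sum _ _ _) _.
apply: ler_sum => k _; rewrite normrM mulrC ler_wpM2r // ffunE.
exact: (tauP k).2.
Qed.

(** * From dominant monomials to bounds on [log_max] *)

Section log_max_bounds.
Context {R : realType} {n : nat}.
Implicit Types (P : 'I_n -> mpoly n R[i]) (z : 'rV[R[i]]_n).

Lemma log_max_le P (q : nat) z (x : R) : (0 < q)%N ->
  (forall k, normc (peval (P k) z) <= expR (q%:R * x)) ->
  (log_max P q z <= x%:E)%E.
Proof.
move=> q0 h; have q0R : (0 : R) < q%:R by rewrite ltr0n.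
rewrite /log_max lee_pdivrMl // -EFinM.
elim/big_ind : _ => [|u v hu hv|k _]; first by rewrite leNye.
  by rewrite ge_max hu hv.
have := h k; have := normc_ge0 (peval (P k) z); rewrite le_eqVlt.
move=> /orP[/eqP <-|p0] hk; first by rewrite le0_lneNy ?leNye.
by rewrite lne_EFin // lee_fin -ler_expR lnK ?posrE.
Qed.

Lemma log_max_ge P (q : nat) z (x : R) k : (0 < q)%N ->
  expR (q%:R * x) <= normc (peval (P k) z) -> (x%:E <= log_max P q z)%E.
Proof.
move=> q0 h; have q0R : (0 : R) < q%:R by rewrite ltr0n.
rewrite /log_max lee_pdivlMl // -EFinM.
apply: le_trans (_ : lne (normc (peval (P k) z))%:E <= _)%E; last first.
  exact: le_bigmax.
have p0 : 0 < normc (peval (P k) z) by apply: lt_le_trans h; exact: expR_gt0.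
by rewrite lne_EFin // lee_fin -ler_expR lnK ?posrE.
Qed.

Lemma mon_expR (m : multinom n) z : mon m z != 0 ->
  mon m z = expR (\sum_k (m k)%:R * ln (normc (z ord0 k))).
Proof.
move=> /prodf_neq0 h; rewrite expR_sum; apply: eq_bigr => k _.
(* Where [m k = 0] the coordinate may vanish; both factors are then [1], whatever the value of
   [ln 0]. *)
rewrite expRM_natl; have [->|mk] := eqVneq (m k) 0%N; first by rewrite !expr0.
rewrite lnK // posrE lt_def normc_ge0 andbT.
by have := h k isT; rewrite expf_eq0 lt0n mk.
Qed.

End log_max_bounds.

Section approximation.
Context {R : realType} {n : nat} (D : set 'rV[R[i]]_n).
Hypothesis D_domain : domain D.
Hypothesis D_bounded : bounded_set D.
Hypothesis D_polyconvex : polynomially_convex D.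
Hypothesis D_reinhardt : reinhardt D.

(* P k is the sum over |m| = q of exp(- N * c k m) * z^(N m), where c k m is a
   generic perturbation of ln (supmon D m). At each point some P k has a
   single dominant term, of relative size at least exp(g * N) for a fixed
   g > 0, so no cancellation occurs once N is large. *)
Lemma approx_log_max (e : R) : (0 < n)%N -> 0 < e ->
  exists (P : 'I_n -> mpoly n R[i]) (q : nat),
    [/\ (0 < q)%N, forall k, P k \is ishomog1 q mdeg &
     forall (t : R) z, 0 < t ->
      (D ((t^-1%:C)%C *: z) -> (log_max P q z <= (ln t + e)%:E)%E) /\
      (~ D ((t^-1%:C)%C *: z) -> ((ln t - e)%:E <= log_max P q z)%E)].
Proof.
move=> n0 e0.
(* The error [e] is shared in the lower bound by the factor [r], by the perturbation of the
   coefficients (at most [e / 3]), and by the final factor [1 / 2]. *)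
pose r := expR (- (e / 3)).
have r01 : 0 < r < 1 by rewrite expR_gt0 expR_lt1; lra.
have [q q0 qP] := uniform_monomials D_domain D_bounded D_polyconvex D_reinhardt r01.
have q1 : (1 : R) <= q%:R by rewrite ler1n.
pose I : finType := {m : bmultinom n q.+1 | mdeg (bmnm m) == q}.
pose a (i : I) : multinom n := bmnm (val i).
have da i : mdeg (a i) = q by apply/eqP; exact: (valP i).
have e3 : 0 < e / 3 by lra.
have sup0 := @supmon_gt0 _ _ _ D_domain D_bounded D_polyconvex D_reinhardt.
have ab i : \sum_k (a i k)%:R = q%:R :> R by rewrite -natr_sum -mdegE da.
have [c cP [g g0 gP]] := @generic_unique_max R n I (fun i k => (a i k)%:R) q%:R
  (fun i => ln (supmon D (a i))) (e / 3) n0 ab e3.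
pose C : R := #|I|%:R.
have C0 : 0 <= C by rewrite ler0n.
(* The three summands ensure in turn that [expR (N * e)] absorbs the number [C] of terms, that
   [expR (N * g)] exceeds [2 * C], so that the other terms add up to at most half of the dominant
   one, and that [expR (N * (e / 3))] absorbs the resulting factor [2]. *)
pose N := Num.bound (C / e + 2 * C / g + 3 / e).
have NP : C / e + 2 * C / g + 3 / e < N%:R.
  by apply: archi_boundP; rewrite !addr_ge0 ?divr_ge0 ?mulr_ge0 //; lra.
have [Ce Cg e3'] : [/\ 0 <= C / e, 0 <= 2 * C / g & 0 < 3 / e].
  by rewrite !divr_gt0 ?divr_ge0 ?mulr_ge0 //; lra.
have N1 : C <= N%:R * e by rewrite -ler_pdivrMr //; lra.
have N2 : 2 * C <= N%:R * g by rewrite -ler_pdivrMr //; lra.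
have N3 : 3 <= N%:R * e by rewrite -ler_pdivrMr //; lra.
have N0 : (0 < N)%N by rewrite -(ltr0n R); lra.
have N0R : (0 : R) < N%:R by rewrite ltr0n.
pose P (k : 'I_n) : mpoly n R[i] :=
  \sum_i ((expR (- c k i) ^+ N)%:C)%C *: mpolyX _ (mnm_muln (a i) N).
pose y (z : 'rV[R[i]]_n) k i := expR (- c k i) * mon (a i) z.
have y0 z k i : 0 <= y z k i by rewrite mulr_ge0 ?mon_ge0 ?expR_ge0.
pose term (z : 'rV[R[i]]_n) k i : R[i] := ((expR (- c k i) ^+ N)%:C)%C *
    \prod_l z ord0 l ^+ (mnm_muln (a i) N) l.
have pevalP z k : peval (P k) z = \sum_i term z k i.
  rewrite /peval /P raddf_sum /=; apply: eq_bigr => i _.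
  by rewrite mevalZ mevalX.
have normterm z k i : normc (term z k i) = y z k i ^+ N.
  rewrite normcM normc_real normc_mevalX monMn ger0_norm ?exprn_ge0 ?expR_ge0 //.
  by rewrite exprMn.
exists P, (q * N)%N; split; first by rewrite muln_gt0 q0.
  move=> k; apply: rpred_sum => i _; apply: rpredZ.
  by rewrite dhomogX -(da i); apply/eqP; exact: mdegMn.
move=> t z t0; have tE := lnK t0.
have QE (x : R) : expR ((q * N)%:R * x) = (expR (q%:R * x)) ^+ N.
  by rewrite -expRM_natl natrM mulrA (mulrC N%:R).
have tq : expR (q%:R * ln t) = t ^+ q by rewrite expRM_natl tE.
split=> Dz.
  apply: log_max_le; first by rewrite muln_gt0 q0.
  move=> k; rewrite pevalP; apply: le_trans (le_normc_sum _ _ _) _.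
  rewrite QE mulrDr expRD tq.
  apply: (@le_trans _ _ (\sum_(i : I) (t ^+ q) ^+ N)).
    apply: ler_sum => i _; rewrite normterm lerXn2r ?nnegrE ?exprn_ge0 ?(ltW t0) //.
    rewrite /y expRN ler_pdivrMl ?expR_gt0 //.
    have -> : z = (t%:C)%C *: ((t^-1%:C)%C *: z).
      by rewrite scalerA -rmorphM /= divff ?gt_eqF // scale1r.
    rewrite monZ da normc_real gtr0_norm // mulrC ler_wpM2r ?exprn_ge0 ?(ltW t0) //.
    apply: (le_trans (le_supmon_D D_bounded (a i) Dz)).
    by have /andP[h _] := cP k i; rewrite -[leLHS]lnK ?posrE ?sup0 // ler_expR.
  rewrite sumr_const -[leLHS]mulr_natl exprMn mulrC ler_wpM2l ?exprn_ge0 ?(ltW t0) //.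
  rewrite -expRM_natl; apply: le_trans (expR_ge1Dx _).
  by rewrite -/C; nra.
have [m mq hm] := qP t z t0 Dz.
have mlt : (mdeg m < q.+1)%N by rewrite mq.
pose i0 : I := exist _ (BMultinom mlt) (introT eqP mq).
pose x k := ln (normc (z ord0 k)).
have mon0 : 0 < mon (a i0) z.
  by apply: lt_le_trans hm; rewrite mulr_gt0 ?exprn_gt0 ?mulr_gt0 ?expR_gt0.
(* Only monomials that do not vanish at [z] compete, since for them alone [x] gives the true
   logarithm; the others satisfy the gap trivially. *)
have [k [i mi iP]] := gP x (fun i => mon (a i) z != 0) i0 (lt0r_neq0 mon0).
have yE j : mon (a j) z != 0 ->
    y z k j = expR (\sum_l (a j l)%:R * x l - c k j).
  by rewrite /y => /mon_expR ->; rewrite expRD mulrC.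
have gap j : j != i -> y z k j <= expR (- g) * y z k i.
  move=> ji; have [mj|mj] := eqVneq (mon (a j) z) 0.
    by rewrite {1}/y mj mulr0 mulr_ge0 ?expR_ge0.
  by rewrite !yE // -expRD ler_expR; have := iP j mj ji; lra.
(* The dominant [i] need not be [i0], but its term is at least as large. The factor
   [expR (- (e / 3))] pays for [c k i0] in place of [ln (supmon D m)]. *)
have yi0 : expR (- (e / 3)) * (r * t) ^+ q <= y z k i.
  apply: (@le_trans _ _ (y z k i0)).
    have /andP[_ hc0] := cP k i0.
    have hc : expR (c k i0) <= supmon D m * expR (e / 3).
      by rewrite -[X in X * _](lnK (sup0 m)) -expRD ler_expR.
    rewrite /y.
    rewrite (expRN (c k i0)) ler_pdivlMl ?expR_gt0 //; apply: le_trans hm.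
    rewrite mulrA mulrC ler_wpM2l ?exprn_ge0 ?mulr_ge0 ?expR_ge0 ?(ltW t0) //.
    by rewrite expRN ler_pdivrMr ?expR_gt0.
  have [->//|ii] := eqVneq i0 i.
  apply: le_trans (gap _ ii) _; rewrite ler_piMl ?y0 // expR_le1; lra.
apply: (@log_max_ge _ _ _ _ _ _ k); first by rewrite muln_gt0 q0.
have half : y z k i ^+ N / 2 <= normc (peval (P k) z).
  rewrite pevalP (bigD1 i) //=.
  set S := \sum_(j | _) _.
  have hS : normc S <= y z k i ^+ N / 2.
    apply: le_trans (le_normc_sum _ _ _) _.
    apply: (@le_trans _ _ (\sum_(j | j != i) (expR (- g) * y z k i) ^+ N)).
      apply: ler_sum => j ji; rewrite normterm lerXn2r ?nnegrE ?gap //.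
      by rewrite mulr_ge0 ?expR_ge0.
    apply: (@le_trans _ _ (\sum_(j : I) (expR (- g) * y z k i) ^+ N)).
      rewrite [leRHS](bigD1 i) //= lerDr exprn_ge0 // mulr_ge0 ?expR_ge0 //.
    rewrite sumr_const -[leLHS]mulr_natl -/C exprMn mulrCA mulrA.
    rewrite [leRHS]mulrC ler_wpM2r ?exprn_ge0 // -expRM_natl mulrN expRN.
    rewrite mulrC ler_pdivrMr ?expR_gt0 //.
    by have := expR_ge1Dx (N%:R * g); lra.

  have := le_normcD (term z k i + S) (- S); rewrite addrK normcN normterm; lra.
apply: le_trans half.
rewrite ler_pdivlMr // QE.
have h2 : expR (q%:R * (ln t - e)) <= expR (- (e / 3)) * (expR (- (e / 3)) * (r * t) ^+ q).
  rewrite exprMn -tq -expRM_natl -!expRD ler_expR; nra.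
apply: (@le_trans _ _ ((expR (- (e / 3)) * y z k i) ^+ N * 2)).
  rewrite ler_pM2r // lerXn2r ?nnegrE ?mulr_ge0 ?expR_ge0 ?mon_ge0 //.
  by apply: le_trans h2 _; rewrite ler_wpM2l ?expR_ge0.
rewrite exprMn mulrAC ler_piMl ?exprn_ge0 // -expRM_natl mulrN expRN.
rewrite mulrC ler_pdivrMr ?expR_gt0 // mul1r.
by have := expR_ge1Dx (N%:R * (e / 3)); lra.
Qed.

End approximation.

(** * Means of logarithms over circles *)

Section circle_means.
Context {R : realType}.
Local Notation mu := (@lebesgue_measure R).
Local Notation circle := (`[0%R, (pi *+ 2)%R]%classic : set R).
Implicit Types f g h : R -> R.

Lemma continuous_integrable f (a b : R) : continuous f ->
  mu.-integrable `[a, b] (EFin \o f).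
Proof.
move=> cf; apply: continuous_compact_integrable; first exact: segment_compact.
exact: continuous_subspaceT.
Qed.

Lemma integral_affine f (u v a b : R) : 0 < u -> a <= b -> continuous f ->
  (\int[mu]_(x in `[(u * a + v)%R, (u * b + v)%R]) (f x)%:E =
   \int[mu]_(x in `[a, b]) (f (u * x + v) * u)%:E)%E.
Proof.
move=> u0 ab cf.
pose F x := u * x + v.
have dF x : is_derive (x : R) 1 F u.
  rewrite /F; apply: is_derive_eq.
  by rewrite addr0 /GRing.scale /= mulr1.
have F'E : derive1 F = cst u.
  by apply/funext => x; rewrite derive1E derive_val.
have cF : continuous F.
  by move=> x; apply: differentiable_continuous; apply/derivable1_diffP.
have -> : (\int[mu]_(x in `[a, b]) (f (u * x + v) * u)%:E =
    \int[mu]_(x in `[a, b]) (((f \o F) * derive1 F) x)%:E)%E.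
  by rewrite F'E.
apply: (@integration_by_substitution_increasing _ F f a b) => //.
- by move=> x y _ _ xy; rewrite /F ltrD2r ltr_pM2l.
- by rewrite F'E => x _; exact: cst_continuous.
- by rewrite F'E; exact: is_cvg_cst.
- by rewrite F'E; exact: is_cvg_cst.
- by split=> [x _ //||]; [exact/cvg_at_right_filter/cF|exact/cvg_at_left_filter/cF].
- exact: continuous_subspaceT.
Qed.

Definition circle_int f : R := fine (\int[mu]_(t in circle) (f t)%:E).

Let pi2_gt0 : 0 < pi *+ 2 :> R.
Proof. by have := @pi_gt0 R; lra. Qed.

Lemma circle_intE f : continuous f ->
  (\int[mu]_(t in circle) (f t)%:E)%E = (circle_int f)%:E.
Proof.
move=> cf; rewrite fineK //; apply: integrable_fin_num => //.
exact: continuous_integrable.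
Qed.

Lemma circle_int_cst c : circle_int (cst c) = c * (pi *+ 2).
Proof.
rewrite /circle_int -[X in fine X]/(\int[mu]_(t in circle) cst c%:E t)%E.
rewrite integral_cst //= lebesgue_measure_itv /= lte_fin pi2_gt0.
by rewrite -EFinD subr0.
Qed.

Lemma circle_intD f g : continuous f -> continuous g ->
  circle_int (f \+ g) = circle_int f + circle_int g.
Proof.
move=> cf cg; apply: EFin_inj; rewrite EFinD -!circle_intE //; last first.
  by move=> x; exact: cvgD (cf x) (cg x).
by rewrite -integralD_EFin //; exact: continuous_integrable.
Qed.

Lemma circle_intZ f c : continuous f -> circle_int (fun t => c * f t) = c * circle_int f.
Proof.
move=> cf; apply: EFin_inj; rewrite EFinM -!circle_intE //; last first.
  by move=> x; exact: cvgMr (cf x).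
by rewrite -integralZl //; exact: continuous_integrable.
Qed.

Lemma circle_int_le f g : continuous f -> continuous g ->
  (forall t, f t <= g t) -> circle_int f <= circle_int g.
Proof.
move=> cf cg fg; rewrite -lee_fin -!circle_intE //.
apply: le_integral => //; [exact: continuous_integrable..|].
by move=> t _; rewrite lee_fin.
Qed.

(* The two half-turns t and t + pi are merged, then rescaled to a full turn. *)
Lemma circle_int_double f h : continuous f -> continuous h ->
  (forall t, f t + f (t + pi) = h (2 * t)) -> circle_int f = circle_int h / 2.
Proof.
move=> cf ch fh; have p0 := @pi_gt0 R.
apply: EFin_inj; rewrite -circle_intE //.
rewrite (@itv_bndbnd_setU _ _ _ (BLeft pi)) ?bnd_simp; [| exact: ltW | lra].
rewrite integral_setU //=; last 2 first.
- rewrite -itv_bndbnd_setU ?bnd_simp; [| exact: ltW | lra].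
  by apply/measurable_EFinP; apply: measurable_funTS; exact: continuous_measurable_fun.
- apply/disj_setPS => x [/=]; rewrite !in_itv /= => /andP[_ xp] /andP[px _].
  by rewrite leNgt xp in px.
rewrite integral_itv_bndo_bndc; last first.
  by apply/measurable_EFinP; apply: measurable_funTS; exact: continuous_measurable_fun.
have cfp : continuous (fun t : R => f (1 * t + pi)).
  move=> x; apply: continuous_comp; last exact: cf.
  by apply: cvgD; [apply: cvgMr; exact: cvg_id|exact: cvg_cst].
have -> : `[pi, pi *+ 2]%classic = `[(1 * 0 + pi)%R, (1 * pi + pi)%R]%classic :> set R.
  by rewrite !mul1r add0r mulr2n.
rewrite integral_affine //; last exact: ltW.
rewrite -integralD_EFin //=; last 2 first.
- exact: continuous_integrable.
- apply: continuous_integrable => x.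
  by apply: cvgM; [exact: cfp | exact: cvg_cst].
transitivity (\int[mu]_(x in `[0%R, pi]) (h (2 * x + 0) * 2 * 2^-1)%:E)%E.
  by apply: eq_integral => x _ /=; rewrite mulr1 mul1r -EFinD fh addr0 mulfK.
have ch2 : continuous (fun x : R => h (2 * x + 0) * 2).
  move=> x; apply: cvgM; last exact: cvg_cst.
  apply: continuous_comp; last exact: ch.
  by apply: cvgD; [apply: cvgMr; exact: cvg_id|exact: cvg_cst].
rewrite mulrC EFinM -circle_intE //.
have -> : circle = `[(2 * 0 + 0)%R, (2 * pi + 0)%R]%classic.
  by rewrite mulr0 !addr0 mulr_natl.
rewrite integral_affine //; last exact: ltW.
rewrite -integralZl //; last exact: continuous_integrable.
by apply: eq_integral => x _; rewrite -EFinM mulrC.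
Qed.

End circle_means.

Lemma normc_sqr (R : rcfType) (a b : R) : normc (a +i* b)%C ^+ 2 = a ^+ 2 + b ^+ 2.
Proof. by rewrite /normc sqr_sqrtr // addr_ge0 ?sqr_ge0. Qed.

Lemma normc_parallelogram (R : rcfType) (x y : R[i]) :
  normc (x + y) ^+ 2 + normc (x - y) ^+ 2 = 2 * (normc x ^+ 2 + normc y ^+ 2).
Proof.
by case: x y => [a b] [c d]; simpc; rewrite !normc_sqr; ring.
Qed.

Section log_means.
Context {R : realType}.
Local Notation mu := (@lebesgue_measure R).
Local Notation circle := (`[0%R, (pi *+ 2)%R]%classic : set R).
Implicit Types (f g h : R -> R) (a b : R[i]).

Let pi2_gt0 : 0 < pi *+ 2 :> R.
Proof. by have := @pi_gt0 R; lra. Qed.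

Lemma continuous_circle a b : continuous (fun t : R => normc (a + b * expi t)).
Proof.
case: a b => [a1 a2] [b1 b2] t.
have -> : (fun t : R => normc ((a1 +i* a2)%C + (b1 +i* b2)%C * expi t)) =
   (fun t => Num.sqrt ((a1 + (b1 * cos t - b2 * sin t)) ^+ 2
                      + (a2 + (b1 * sin t + b2 * cos t)) ^+ 2)).
  by apply/funext => s; rewrite /expi; simpc.
apply: continuous_comp; last exact: sqrt_continuous.
have cM (c : R) (f : R -> R) : {for t, continuous f} ->
    {for t, continuous (fun s => c * f s)} by move=> cf; exact: cvgMr.
have cX (f : R -> R) : {for t, continuous f} ->
    {for t, continuous (fun s => f s ^+ 2)}.
  move=> cf; apply: (@continuous_comp _ _ _ f (fun x : R => x ^+ 2)) => //.
  exact: exprn_continuous.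
have cc := @continuous_cos R t; have cs := @continuous_sin R t.
apply: cvgD; apply: cX; apply: cvgD; try exact: cvg_cst.
  by apply: cvgB; exact: cM.
by apply: cvgD; exact: cM.
Qed.

Lemma continuous_ln_pos f : (forall t, 0 < f t) -> continuous f ->
  continuous (fun t => ln (f t)).
Proof.
move=> f0 cf t; apply: (@continuous_comp _ _ _ f (@ln R)); first exact: cf.
exact: continuous_ln.
Qed.

(** By the parallelogram law the values at [t] and [t + pi] have a constant sum, so
    [circle_int_double] reduces the integral to that of a constant. *)
Lemma circle_int_sqr_normc a b :
  circle_int (fun t => normc (a + b * expi t) ^+ 2) =
  (normc a ^+ 2 + normc b ^+ 2) * (pi *+ 2).
Proof.
have -> := @circle_int_double R _ (cst (2 * (normc a ^+ 2 + normc b ^+ 2))).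
- by rewrite circle_int_cst; lra.
- move=> t; apply: (@continuous_comp _ _ _ (fun t => normc (a + b * expi t))
      (fun x : R => x ^+ 2)); first exact: continuous_circle.
  exact: exprn_continuous.
- exact: cst_continuous.
- move=> t; rewrite expiDpi mulrN normc_parallelogram /= normcM normc_expi.
  by rewrite mulr1.
Qed.

Lemma circle_gt0 a b t : normc b < normc a -> 0 < normc (a + b * expi t).
Proof.
move=> ba; have := normc_triangle a (- (b * expi t)) 0.
by rewrite opprK !subr0 normcN normcM normc_expi; lra.
Qed.

(* The error E(a, b) satisfies E(a, b) = E(a^2, - b^2) / 2, because
   |a + b e^(it)| |a - b e^(it)| = |a^2 - b^2 e^(2it)|, and |b / a| does not
   increase, so that one crude bound for E is halved k times. *)
Lemma circle_int_ln_bound (r : R) k a b : 0 <= r < 1 -> 0 < normc a ->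
  normc b <= r * normc a ->
  `|circle_int (fun t => ln (normc (a + b * expi t))) - ln (normc a) * (pi *+ 2)|
  * 2 ^+ k <= - ln (1 - r) * (pi *+ 2).
Proof.
move=> /andP[r0 r1] a0 rb; set K := - ln (1 - r).
have K0 : 0 <= K by rewrite oppr_ge0 ln_le0 //; lra.
have rlt (x y : R) : 0 < x -> y <= r * x -> y < x.
  by move=> x0 /le_lt_trans; apply; rewrite gtr_pMl.
elim: k a b a0 rb => [|k IH] a b a0 rb.
  have ba : normc b < normc a := rlt _ _ a0 rb.
  rewrite expr0 mulr1 -circle_int_cst.
  have cl : continuous (fun t => ln (normc (a + b * expi t))).
    by apply: continuous_ln_pos => [t|]; [exact: circle_gt0|exact: continuous_circle].
  have bnd t : ln (normc a) - K <= ln (normc (a + b * expi t)) <= ln (normc a) + K.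
    have nt : normc (a + b * expi t) <= (1 + r) * normc a.
      apply: le_trans (le_normcD _ _) _; rewrite normcM normc_expi mulr1; lra.
    have nt2 : (1 - r) * normc a <= normc (a + b * expi t).
      have := normc_triangle a (- (b * expi t)) 0.
      by rewrite opprK !subr0 normcN normcM normc_expi; lra.
    rewrite /K opprK; apply/andP; split.
      rewrite addrC -lnM ?posrE //; last lra.
      by rewrite ler_ln ?posrE //; [rewrite mulr_gt0 //; lra | exact: circle_gt0].
    apply: (@le_trans _ _ (ln ((1 + r) * normc a))).
      by rewrite ler_ln ?posrE //; [exact: circle_gt0 | rewrite mulr_gt0 //; lra].
    rewrite lnM ?posrE //; last lra.
    rewrite addrC lerD2l -lnV ?posrE; last lra.
    rewrite ler_ln ?posrE ?invr_gt0; [|lra|lra].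
    by rewrite -div1r ler_pdivlMr; nra.
  have ccst (c : R) : continuous (cst c : R -> R).
    by move=> x; exact: cst_continuous.
  have h1 := @circle_int_le R (cst (ln (normc a) - K)) _ (ccst _) cl
    (fun t => proj1 (andP (bnd t))).
  have h2 := @circle_int_le R _ (cst (ln (normc a) + K)) cl (ccst _)
    (fun t => proj2 (andP (bnd t))).
  rewrite !circle_int_cst in h1 h2 *.
  by rewrite ler_norml; apply/andP; split; lra.
have ba : normc b < normc a := rlt _ _ a0 rb.
have ba2 : normc (- b ^+ 2) < normc (a ^+ 2).
  by rewrite normcN !normcX ltrXn2r ?nnegrE ?normc_ge0.
have rb2 : normc (- b ^+ 2) <= r * normc (a ^+ 2).
  rewrite normcN !normcX; apply: le_trans (_ : (r * normc a) ^+ 2 <= _).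
    by rewrite lerXn2r ?nnegrE ?mulr_ge0 ?normc_ge0.
  by rewrite exprMn ler_wpM2r ?exprn_ge0 ?normc_ge0 // expr2 ler_piMl // ltW.
have a20 : 0 < normc (a ^+ 2) by rewrite normcX exprn_gt0.
have := IH _ _ a20 rb2.
rewrite (@circle_int_double R (fun t => ln (normc (a + b * expi t)))
  (fun t => ln (normc (a ^+ 2 + - b ^+ 2 * expi t)))); first last.
- move=> t; rewrite expiDpi mulrN -lnM ?posrE ?circle_gt0 //; last first.
    have := @circle_gt0 a (- b) t; rewrite mulNr; apply.
    by rewrite normcN.
  rewrite -normcM; congr (ln (normc _)).
  have -> : 2 * t = t + t by ring.
  by rewrite expiD; ring.
- by apply: continuous_ln_pos => [t|]; [exact: circle_gt0|exact: continuous_circle].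
- by apply: continuous_ln_pos => [t|]; [exact: circle_gt0|exact: continuous_circle].
have -> : ln (normc (a ^+ 2)) = 2 * ln (normc a).
  by rewrite normcX lnXn // mulr_natl.
set J := circle_int _.
have -> : J - 2 * ln (normc a) * (pi *+ 2) = 2 * (J / 2 - ln (normc a) * (pi *+ 2)).
  by field.
by rewrite normrM ger0_norm // exprS mulrCA mulrA.
Qed.

Lemma circle_int_ln a b : normc b < normc a ->
  circle_int (fun t => ln (normc (a + b * expi t))) = ln (normc a) * (pi *+ 2).
Proof.
move=> ba; have a0 : 0 < normc a := le_lt_trans (normc_ge0 b) ba.
pose r := normc b / normc a.
have r1 : r < 1 by rewrite ltr_pdivrMr // mul1r.
have r0 : 0 <= r by rewrite divr_ge0 ?normc_ge0.
pose K := - ln (1 - r).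
have K0 : 0 <= K by rewrite oppr_ge0 ln_le0 //; lra.
have r01 : 0 <= r < 1 by rewrite r0.
have rb : normc b <= r * normc a by rewrite divfK ?gt_eqF.
apply/eqP; rewrite -subr_eq0 -normr_eq0; apply/eqP.
set x := `|_|; have x0 : 0 <= x by exact: normr_ge0.
apply/eqP; rewrite eq_le x0 andbT leNgt; apply/negP => {}x0.
pose N := Num.bound (K * (pi *+ 2) / x).
have : K * (pi *+ 2) / x < N%:R.
  by apply: archi_boundP; rewrite divr_ge0 ?mulr_ge0 ?(ltW x0) ?(ltW pi2_gt0).
rewrite ltr_pdivrMr // => h; have := @circle_int_ln_bound r N _ _ r01 a0 rb; rewrite -/x.
have N2 : N%:R <= 2 ^+ N :> R by rewrite -natrX ler_nat ltnW // ltn_expl.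
rewrite leNgt => /negP; apply; apply: lt_le_trans h _.
by rewrite mulrC ler_wpM2l // ltW.
Qed.

End log_means.

Lemma lee_real_lt (R : realType) (x y : \bar R) :
  (forall A : R, A%:E < x -> A%:E <= y)%E -> (x <= y)%E.
Proof.
move=> h; rewrite leNgt; apply/negP => yx.
have [A yA Ax] : exists2 A : R, (y < A%:E)%E & (A%:E < x)%E.
  case: x y yx {h} => [x| |] [y| |] //.
  - rewrite lte_fin => yx; exists ((x + y) / 2); rewrite lte_fin; lra.
  - by move=> _; exists (x - 1); rewrite ?ltNyr // lte_fin; lra.
  - by move=> _; exists (y + 1); rewrite ?ltry // lte_fin; lra.
  - by move=> _; exists 0; rewrite ?ltNyr ?ltry.
by have := h A Ax; rewrite leNgt yA.
Qed.

Lemma lte_EFin_subl (R : realType) (A M : R) (L : \bar R) :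
  (A%:E < M%:E - L)%E = (L < (M - A)%:E)%E.
Proof.
case: L => [l| |] /=; last 2 first.
- by rewrite addeNy ltNge leNye ltNge leey.
- by rewrite addey // ltNyr ltry.
by rewrite -EFinB !lte_fin ltrBrDr ltrBrDl.
Qed.

Lemma le_limn_einf (R : realType) (u : nat -> \bar R) (x : \bar R) :
  (forall A : R, (A%:E < x)%E -> \forall k \near \oo, (A%:E <= u k)%E) ->
  (x <= limn_einf u)%E.
Proof.
move=> h; rewrite limn_einf_lim; have /cvg_lim -> // := @cvg_einfs_sup _ u.
apply: lee_real_lt => A /h[N _ NA].
apply: (le_trans _ (ereal_sup_ubound (ex_intro2 _ _ N Logic.I erefl))).
by apply: le_ereal_inf_tmp => _ [k /= Nk <-]; exact: NA.
Qed.

(** * Jensen's inequality for products of affine factors *)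

Section jensen.
Context {R : realType}.
Local Notation mu := (@lebesgue_measure R).
Local Notation circle := (`[0%R, (pi *+ 2)%R]%classic : set R).
Implicit Types (f g : R -> R) (a b : R[i]).
Local Open Scope ereal_scope.

Let pi2_gt0 : (0 < pi *+ 2 :> R)%R.
Proof. by have := @pi_gt0 R; lra. Qed.

Lemma lneM_ge0 (x y : R) : (0 <= x)%R -> (0 <= y)%R ->
  lne (x * y)%:E = lne x%:E + lne y%:E.
Proof.
rewrite !le_eqVlt => /predU1P[<-|x0] /predU1P[<-|y0].
- by rewrite mulr0 le0_lneNy.
- by rewrite mul0r le0_lneNy // lne_EFin.
- by rewrite mulr0 (@le0_lneNy _ 0) // lne_EFin.
- by rewrite !lne_EFin ?mulr_gt0 // lnM.
Qed.

Lemma lne_lt (x A : R) : (0 <= x)%R -> (lne x%:E < A%:E) = (x < expR A)%R.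
Proof.
rewrite le_eqVlt => /predU1P[<-|x0].
  by rewrite le0_lneNy // ltNyr expR_gt0.
by rewrite lne_EFin // lte_fin -[in RHS](lnK x0) ltr_expR.
Qed.

Lemma lne_neqy (x : R) : lne x%:E != +oo.
Proof. by rewrite /=; case: ifP. Qed.

Lemma measurable_lne_comp f : continuous f -> (forall t, 0 <= f t)%R ->
  measurable_fun setT (fun t => lne (f t)%:E).
Proof.
move=> cf f0.
have : lower_semicontinuous (fun t => - lne (f t)%:E).
  apply/lower_semicontinuousP => A.
  have -> : [set x | A%:E < - lne (f x)%:E] = f @^-1` [set y | (y < expR (- A))%R].
    apply/seteqP; split => t /=; rewrite -lne_lt // EFinN; first by rewrite lteNr.
    by rewrite lteNr.
  by apply: open_comp => [x _|]; [exact: cf | exact: open_lt].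
move=> /lower_semicontinuous_measurable mf.
rewrite (_ : (fun t => _) = -%E \o (fun t => - lne (f t)%:E)).
  exact: measurableT_comp.
by apply/funext => t /=; rewrite oppeK.
Qed.

(** Integrability is part of the notion because integrals of functions with value [-oo] add up only
    under such a condition; with it the inequality passes to products, and monomials are treated one
    factor at a time. *)
Definition jensen f (m : R) := [/\ (0 < m)%R, forall t, (0 <= f t)%R,
  mu.-integrable circle (fun t => lne (f t)%:E) &
  ((ln m) * (pi *+ 2))%:E <= \int[mu]_(t in circle) lne (f t)%:E].

Lemma jensenM f g m p : jensen f m -> jensen g p ->
  jensen (fun t => f t * g t)%R (m * p).
Proof.
move=> [m0 f0 intf hf] [p0 g0 intg hg].
have E : (fun t => lne (f t * g t)%:E) = (fun t => lne (f t)%:E + lne (g t)%:E).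
  by apply/funext => t; exact: lneM_ge0.
split => /=; first exact: mulr_gt0.
- by move=> t; exact: mulr_ge0.
- by rewrite E; exact: integrableD.
- by rewrite E integralD // lnM // mulrDl EFinD leeD.
Qed.

Lemma jensen_cst (m : R) : (0 < m)%R -> jensen (cst m) m.
Proof.
move=> m0; split => //=; first by move=> t; exact: ltW.
  rewrite -[if _ then _ else _]/(lne m%:E) lne_EFin //.
  by apply: (@continuous_integrable _ (cst (ln m))) => x; exact: cst_continuous.
rewrite -[if _ then _ else _]/(lne m%:E) lne_EFin //.
rewrite -circle_int_cst -circle_intE // => x; exact: cst_continuous.
Qed.

Lemma jensen_exp f m k : jensen f m -> jensen (fun t => f t ^+ k)%R (m ^+ k).
Proof.
move=> fm; elim: k => [|k IH]; first exact: jensen_cst.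
under [X in jensen X _]eq_fun do rewrite exprS.
by rewrite exprS; exact: jensenM.
Qed.

Lemma jensen_prod (I : Type) (s : seq I) (F : I -> R -> R) (m : I -> R) :
  (forall i, jensen (F i) (m i)) ->
  jensen (fun t => \prod_(i <- s) F i t)%R (\prod_(i <- s) m i).
Proof.
move=> h; elim: s => [|i s IH].
  rewrite big_nil; under [X in jensen X _]eq_fun do rewrite big_nil.
  exact: jensen_cst.
rewrite big_cons; under [X in jensen X _]eq_fun do rewrite big_cons.
exact: jensenM.
Qed.

Lemma jensen_of_ln f m : continuous f -> (forall t, 0 < f t)%R -> (0 < m)%R ->
  (ln m * (pi *+ 2) <= circle_int (fun t => ln (f t)))%R -> jensen f m.
Proof.
move=> cf f0 m0 h.
have E : (fun t => lne (f t)%:E) = EFin \o (fun t => ln (f t)).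
  by apply/funext => t; rewrite lne_EFin.
have cl := continuous_ln_pos f0 cf.
split => //; first by move=> t; exact: ltW.
- by rewrite E; exact: continuous_integrable.
- by rewrite E circle_intE.
Qed.

Local Open Scope ring_scope.

Lemma jensen_lt a b : (normc b < normc a)%R ->
  jensen (fun t => normc (a + b * expi t)) (normc a).
Proof.
move=> ba; apply: jensen_of_ln; first exact: continuous_circle.
- by move=> t; exact: circle_gt0.
- exact: le_lt_trans (normc_ge0 b) ba.
- by rewrite circle_int_ln.
Qed.

Lemma normc_conj (x : R[i]) : normc (conjc x) = normc x.
Proof. by case: x => x y; rewrite /normc /= sqrrN. Qed.

(** Conjugating and factoring out [expi t] exchanges the roles of [a] and [b], so the mean is
    [ln (normc b)], which exceeds [ln (normc a)]. *)
Lemma jensen_gt a b : (0 < normc a)%R -> (normc a < normc b)%R ->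
  jensen (fun t => normc (a + b * expi t)) (normc a).
Proof.
move=> a0 ab; have [_ h0 hint hb] : jensen
    (fun t => normc (conjc b + conjc a * expi t)) (normc (conjc b)).
  by apply: jensen_lt; rewrite !normc_conj.
have E t : normc (a + b * expi t) = normc (conjc b + conjc a * expi t).
  rewrite -[LHS]mul1r -(normc_expi (- t)) -normcM mulrDr mulrCA -expiD addNr.
  rewrite expi0 mulr1 -normc_conj rmorphD rmorphM addrC; congr (normc (_ + _)).
  by rewrite mulrC; congr (_ * _); rewrite /expi /= cosN sinN opprK.
have {}E : (fun t => normc (a + b * expi t)) =
    (fun t => normc (conjc b + conjc a * expi t)) by exact/funext.
rewrite E; split => //.
  apply: le_trans hb; rewrite normc_conj lee_fin ler_wpM2r ?(ltW pi2_gt0) //.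
  by rewrite ler_ln ?posrE ?(ltW ab) // (lt_trans a0 ab).
Qed.

(* Fatou's lemma along the smaller radii normc b * k / (k + 1), for which
   the mean of the logarithm is exactly ln (normc a). *)
Lemma jensen_eq a b : (0 < normc a)%R -> (normc b = normc a)%R ->
  jensen (fun t => normc (a + b * expi t)) (normc a).
Proof.
move=> a0 ba.
pose s (k : nat) : R := (1 - k.+1%:R^-1)%R.
have s01 k : (0 <= s k < 1)%R.
  rewrite /s subr_ge0 invf_le1 ?ltr0n // ler1n /=.
  by rewrite ltrBlDr ltrDl invr_gt0 ltr0n.
(* [M] bounds all the moduli involved, so subtracting the logarithms from [ln M] gives the
   nonnegative functions required by Fatou's lemma. *)
pose M := (2 * normc a)%R.
have M0 : (0 < M)%R by rewrite mulr_gt0.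
pose c k : R[i] := (((s k)%:C)%C * b)%R.
have nc k : (normc (c k) = s k * normc a)%R.
  by rewrite normcM normc_real ba ger0_norm //; have /andP[] := s01 k.
have ca k : (normc (c k) < normc a)%R.
  by rewrite nc gtr_pMl //; have /andP[] := s01 k.
pose F k t := ((ln M)%:E - lne (normc (a + c k * expi t))%:E)%E.
pose G t := ((ln M)%:E - lne (normc (a + b * expi t))%:E)%E.
have leM d t : (normc d <= normc a)%R -> (lne (normc (a + d * expi t))%:E <= (ln M)%:E)%E.
  move=> da; rewrite leNgt; apply/negP => h.
  have := le_normcD a (d * expi t); rewrite normcM normc_expi mulr1 => h2.
  have : (normc (a + d * expi t) <= M)%R by rewrite /M; lra.
  rewrite leNgt => /negP; apply; rewrite -lte_fin.
  have := normc_ge0 (a + d * expi t); rewrite le_eqVlt => /predU1P[h0|h0].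
    by move: h; rewrite -h0 le0_lneNy.
  by move: h; rewrite lne_EFin // !lte_fin ltr_ln ?posrE.
have mG : measurable_fun circle (fun t => lne (normc (a + b * expi t))%:E).
  apply: measurable_funTS; apply: measurable_lne_comp; first exact: continuous_circle.
  by move=> t; exact: normc_ge0.
have mF k : measurable_fun circle (fun t => lne (normc (a + c k * expi t))%:E).
  apply: measurable_funTS; apply: measurable_lne_comp; first exact: continuous_circle.
  by move=> t; exact: normc_ge0.
have F0 k t : circle t -> (0 <= F k t)%E.
  by move=> _; rewrite subre_ge0 //; apply: leM; exact: ltW.
have G0 t : circle t -> (0 <= G t)%E by move=> _; rewrite subre_ge0 //; apply: leM; rewrite ba.
have intF k : (\int[mu]_(t in circle) F k t =
    ((ln M - ln (normc a)) * (pi *+ 2))%:E)%E.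
  have cl : continuous (fun t => ln (normc (a + c k * expi t))).
    by apply: continuous_ln_pos => [t|];
      [exact: circle_gt0 | exact: continuous_circle].
  have -> : F k = EFin \o (cst (ln M) \+ (fun t => -1 * ln (normc (a + c k * expi t)))).
    by apply/funext => t; rewrite /F lne_EFin ?circle_gt0 //= mulN1r.
  have cM : continuous (cst (ln M) : R -> R) by move=> x; exact: cst_continuous.
  have cN : continuous (fun t => -1 * ln (normc (a + c k * expi t))).
    by move=> x; exact: cvgMr (cl x).
  rewrite circle_intE; last by move=> x; exact: cvgD (cM x) (cN x).
  by rewrite circle_intD // circle_intZ // circle_int_cst circle_int_ln //; congr EFin; ring.
have mM : measurable_fun circle (cst (ln M)%:E) by exact: measurable_cst.
(* This includes the zeros of [a + b * expi t], where [G t = +oo] and [F k t] eventually exceeds any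
   [A]. *)
have GF t : circle t -> (G t <= limn_einf (F ^~ t))%E.
  move=> _; apply: le_limn_einf => A; rewrite /G lte_EFin_subl lne_lt ?normc_ge0 // => h.
  have hx : 0 < expR (ln M - A) - normc (a + b * expi t) by rewrite subr_gt0.
  pose e := expR (ln M - A) - normc (a + b * expi t).
  exists (Num.bound (normc a / e)) => // k /= Nk.
  rewrite /F ltW // lte_EFin_subl lne_lt ?normc_ge0 //.
  have := normc_triangle (a + c k * expi t) (a + b * expi t) 0.
  rewrite !subr0.
  have -> : a + c k * expi t - (a + b * expi t) = - (k.+1%:R^-1%:C)%C * b * expi t.
    by rewrite /c /s rmorphB rmorph1; ring.
  rewrite normcM normc_expi mulr1 mulNr normcN normcM ba normc_real.
  rewrite ger0_norm ?invr_ge0 // => h1.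
  have h2 : k.+1%:R^-1 * normc a < e.
    rewrite mulrC ltr_pdivrMr ?ltr0n // -ltr_pdivrMl // mulrC.
    apply: lt_trans (archi_boundP _) _; first by rewrite divr_ge0 // ltW.
    by rewrite ltr_nat ltnS.
  by apply: le_lt_trans h1 _; rewrite -ltrBrDr.
have hG : (\int[mu]_(t in circle) G t <= ((ln M - ln (normc a)) * (pi *+ 2))%:E)%E.
  have mFk k : measurable_fun circle (F k) by exact: emeasurable_funB.
  apply: (@le_trans _ _ (\int[mu]_(t in circle) limn_einf (F ^~ t))%E).
    apply: ge0_le_integral => //; first exact: emeasurable_funB.
    rewrite /limn_einf; apply: measurableT_comp => //.
    apply: measurable_fun_limn_esup => k; apply: measurableT_comp => //.
    exact: mFk.
  apply: le_trans (@fatou _ _ R mu circle _ F mFk F0) _ => //.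
  have -> : (fun k => \int[mu]_(t in circle) F k t)%E =
      cst ((ln M - ln (normc a)) * (pi *+ 2))%:E by exact/funext.
  set v := _%:E; have cv : (cst v : nat -> \bar R) @ \oo --> v by exact: cvg_cst.
  by have [-> _] := cvg_limn_einf_sup cv.
have iG : mu.-integrable circle G.
  apply/integrableP; split; first exact: emeasurable_funB.
  under eq_integral => t /set_mem ct do rewrite gee0_abs ?G0 //.
  exact: le_lt_trans hG (ltry _).
have iM : mu.-integrable circle (cst (ln M)%:E).
  by apply: (@continuous_integrable _ (cst (ln M))) => x; exact: cst_continuous.
have E : (fun t => lne (normc (a + b * expi t))%:E) = (cst (ln M)%:E \- G)%E.
  apply/funext => t; rewrite /G /= oppeB ?fin_num_adde_defr // addeA.
  by rewrite -EFinB subrr add0e.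
split => //; first by move=> t; exact: normc_ge0.
  by rewrite E; exact: integrableB.
rewrite E integralB //.
rewrite integral_cst //= lebesgue_measure_itv /= lte_fin pi2_gt0 -EFinD subr0.
have Gfin := integrable_fin_num _ iG.
rewrite leeBrDr ?Gfin //; apply: le_trans (leeD2l _ hG) _.
by rewrite -EFinD -EFinM lee_fin; lra.
Qed.

Lemma jensen_linear a b : 0 < normc a ->
  jensen (fun t => normc (a + b * expi t)) (normc a).
Proof.
move=> a0; have [ab|ab|ab] := ltgtP (normc a) (normc b).
- exact: jensen_gt.
- exact: jensen_lt.
- exact: jensen_eq.
Qed.

End jensen.

(** * Maximum principle on annuli *)

(** If each [x] is beaten by some [y x], choose a real [b x] strictly between the two values.
    Finitely many of the sets [f < b x] cover [A]; for the largest such [b x], the point [y x] lies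
    in none of them. *)
Lemma usc_attains_max (R : realType) (T : ptopologicalType) (A : set T)
    (f : T -> \bar R) : compact A -> A !=set0 ->
  (forall x, A x -> forall a : R, (f x < a%:E)%E -> \forall y \near x, (f y < a%:E)%E) ->
  exists2 x0, A x0 & forall x, A x -> (f x <= f x0)%E.
Proof.
move=> cA [z Az] uf; apply: contrapT => /forall2NP noM.
have /choice[y yP] x : exists y, A x -> A y /\ (f x < f y)%E.
  have [Ax|Ax] := pselect (A x); last by exists x.
  have [//|/existsNP[y /not_implyP[Ay /negP]]] := noM x.
  by rewrite -ltNge; exists y.
have /choice[b bP] x : exists b : R, A x -> (f x < b%:E)%E /\ (b%:E < f (y x))%E.
  have [Ax|Ax] := pselect (A x); last by exists 0.
  apply: contrapT => /forallNP h.
  have : (f (y x) <= f x)%E.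
    apply: lee_real_lt => a ay; rewrite leNgt; apply/negP => xa.
    by apply: (h a) => _.
  by rewrite leNgt (yP x Ax).2.
pose U x := [set w | (f w < (b x)%:E)%E]^°.
have : finite_subset_cover A U A.
  move: cA; rewrite compact_cover; apply.
    by move=> x _; exact: open_interior.
  by move=> x Ax; exists x => //; apply: uf => //; exact: (bP x Ax).1.
move=> [F FA AF].
have [x1 /= x1F _] := AF z Az.
pose I := seq_sub F.
pose x2 : I := [arg max_(i > SeqSub x1F) b (val i)]%O.
have Ax2 : A (val x2) by have := FA _ (valP x2); rewrite inE.
have [x3 /= x3F] := AF _ (yP _ Ax2).1.
move=> /interior_subset /= h.
have le32 : b x3 <= b (val x2).
  rewrite /x2; case: arg_maxP => // i _ /(_ (SeqSub x3F) isT); exact.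
have := lt_trans (bP _ Ax2).2 h.
by rewrite lte_fin ltNge le32.
Qed.

Section maximum_principle.
Context {R : realType}.
Local Notation mu := (@lebesgue_measure R).
Local Notation circle := (`[0%R, (pi *+ 2)%R]%classic : set R).
Implicit Types (v : R[i] -> \bar R).

Lemma continuous_expi_path (a b : R[i]) : continuous (fun t : R => a + b * expi t).
Proof.
move=> t A /nbhs_normcP[d d0 dA].
have ct := @continuous_circle R (- (b * expi t)) b t.
have t0 : normc (- (b * expi t) + b * expi t) = 0 by rewrite addNr normc0.
have := @cvgr_lt _ _ _ _ _ _ ct d; rewrite t0 => /(_ _ d0) h.
apply: filterS h => s h; apply: dA; apply: le_lt_trans h.
by rewrite le_eqVlt; apply/orP; left; apply/eqP; congr normc; ring.
Qed.

(** [f] may fail to be integrable, so positive and negative parts are compared separately. *)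
Lemma integral_circle_le (f : R -> \bar R) (h : R -> R) :
  measurable_fun circle f -> continuous h ->
  (forall t, (f t <= (h t)%:E)%E) ->
  (\int[mu]_(t in circle) f t <= (circle_int h)%:E)%E.
Proof.
move=> mf ch fh; rewrite -circle_intE //.
have mh : measurable_fun circle (EFin \o h).
  by apply/measurable_EFinP; apply: measurable_funTS; exact: continuous_measurable_fun.
rewrite integralE [leRHS]integralE leeB //.
- apply: ge0_le_integral => //.
  + exact: measurable_funepos.
  + exact: measurable_funepos.
  + by move=> t ct; apply: (funepos_le (D := circle)) => [x _|]; [exact: fh | exact: mem_set].
- apply: ge0_le_integral => //.
  + exact: measurable_funeneg.
  + exact: measurable_funeneg.
  + by move=> t ct; apply: (funeneg_le (D := circle)) => [x _|]; [exact: fh | exact: mem_set].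
Qed.

(* A maximum of the perturbation v - s ln|l| + kappa |l|^2 cannot be interior:
   the mean of ln|l| over a small circle is its value at the center, while
   that of |l|^2 is strictly larger. *)
Lemma annulus_maximum (Omega : set R[i]) v (r1 r2 s B : R) :
  subharmonic Omega v -> 0 < r1 ->
  (forall l, r1 <= normc l <= r2 -> Omega l) ->
  (forall l, normc l = r1 \/ normc l = r2 -> (v l <= (s * ln (normc l) + B)%:E)%E) ->
  forall l, r1 <= normc l <= r2 -> (v l <= (s * ln (normc l) + B)%:E)%E.
Proof.
move=> [usc vlt mean] r10 sub bd l1 Al1; rewrite leNgt; apply/negP => hl1.
pose A := [set l : R[i] | r1 <= normc l <= r2].
have r20 : 0 < r2 by have /andP[h1 h2] := Al1; lra.
(* [k] is so small that the excess of [v] at [l1] survives the largest value [k * r2 ^+ 2] of the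
   perturbation; this later excludes a maximum on the boundary. *)
have [k k0 hk] : exists2 k : R, 0 < k &
    ((s * ln (normc l1) + B + k * r2 ^+ 2)%:E < v l1)%E.
  have := vlt _ (sub _ Al1); move: hl1; case: (v l1) => [x| |] //.
  rewrite lte_fin => hx _; pose d := x - (s * ln (normc l1) + B).
  have d0 : 0 < d by rewrite subr_gt0.
  exists (d / 2 / r2 ^+ 2); first by rewrite !divr_gt0 ?exprn_gt0.
  by rewrite divfK ?gt_eqF ?exprn_gt0 // lte_fin /d in d0 *; lra.
pose g (l : R[i]) := s * ln (normc l) - k * normc l ^+ 2.
have A0 l : A l -> 0 < normc l by move=> /andP[h _]; lra.
have cg l : 0 < normc l -> {for l, continuous g}.
  move=> l0.
  have c1 : {for l, continuous (fun w : R[i] => ln (normc w))}.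
    apply: (@continuous_comp _ _ _ (@normc R) (@ln R)); last exact: continuous_ln.
    exact: continuous_normc.
  have c2 : {for l, continuous (fun w : R[i] => normc w ^+ 2)}.
    apply: (@continuous_comp _ _ _ (@normc R) (fun x : R => x ^+ 2)).
      exact: continuous_normc.
    exact: exprn_continuous.
  have c3 : {for l, continuous (fun w : R[i] => s * ln (normc w))}.
    by exact: cvgMr c1.
  have c4 : {for l, continuous (fun w : R[i] => k * normc w ^+ 2)}.
    by exact: cvgMr c2.
  by exact: cvgB c3 c4.
pose f l := (v l - (g l)%:E)%E.
have cA : compact A.
  have cl : closed A.
    have -> : A = @normc R @^-1` [set x | r1 <= x] `&` @normc R @^-1` [set x | x <= r2].
      by apply/seteqP; split => l; [move=> /andP[] | move=> [h1 h2]; apply/andP].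
    apply: closedI; (apply: closed_comp => [x _|]; first exact: continuous_normc).
      exact: closed_ge.
    exact: closed_le.
  by apply: (subclosed_compact cl (@compact_disc _ r2)) => l /andP[].
have [l0 Al0 maxl0] : exists2 l0, A l0 & forall l, A l -> (f l <= f l0)%E.
  apply: usc_attains_max cA _ _; first by exists l1.
  move=> l Al a; rewrite /f lteBlDr // -EFinD => va.
  have [b vb ba] : exists2 b : R, (v l < b%:E)%E & b < a + g l.
    apply: contrapT => /forall2NP h; move: va; apply/negP; rewrite -leNgt.
    apply: lee_real_lt => b; rewrite lte_fin => ba; rewrite leNgt; apply/negP => vb.
    by have [] := h b.
  have n1 := usc l (sub l Al) b vb.
  have ba' : b - a < g l by lra.
  have n2 : \forall w \near l, b - a < g w.
    exact: (cvgr_gt _ (cg l (A0 l Al))).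
  apply: filterS2 n1 n2 => w h1 h2; rewrite lteBlDr // -EFinD.
  by apply: lt_trans h1 _; rewrite lte_fin; lra.
(* [v l0 = -oo] is impossible: [f l0] would fall below [f l1], and [v l1] exceeds a real number. *)
have [M vM] : exists M, v l0 = (M + g l0)%:E.
  have := maxl0 l1 Al1; have := vlt _ (sub _ Al0); rewrite /f.
  case: (v l0) => [x| |] // _; first by exists (x - g l0); rewrite subrK.
  move: hk; case: (v l1) => [x| |] //.
have vle l : A l -> (v l <= (M + g l)%:E)%E.
  by move=> /maxl0; rewrite /f vM -EFinB addrK leeBlDr // -EFinD.
have MB : B + k * r2 ^+ 2 < M.
  have := lt_le_trans hk (vle _ Al1); rewrite lte_fin /g.
  have := mulr_ge0 (ltW k0) (sqr_ge0 (normc l1)); lra.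
have nobd : r1 < normc l0 < r2.
  have /andP[h1 h2] := Al0.
  have kr : k * normc l0 ^+ 2 <= k * r2 ^+ 2.
    by rewrite ler_wpM2l ?(ltW k0) // lerXn2r ?nnegrE ?normc_ge0 ?(ltW r20).
  rewrite !lt_neqAle h1 h2 !andbT; apply/andP; split; apply/negP => /eqP e.
    by have := bd l0 (or_introl (esym e)); rewrite vM lee_fin /g; lra.
  by have := bd l0 (or_intror e); rewrite vM lee_fin /g; lra.
have /andP[h1 h2] := nobd.
pose rho := Num.min (normc l0 - r1) (r2 - normc l0).
have rho0 : 0 < rho by rewrite lt_min !subr_gt0 h1.
have rho1 : rho <= normc l0 - r1 by rewrite ge_min lexx.
have rho2 : rho <= r2 - normc l0 by rewrite ge_min lexx orbT.
have disc w : normc (w - l0) <= rho -> A w.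
  move=> hw; apply/andP; split.
    have := normc_triangle l0 w 0; rewrite !subr0 normc_sub; lra.
  have := normc_triangle w l0 0; rewrite !subr0; lra.
have := mean l0 rho rho0 (fun w hw => sub _ (disc w hw)).
pose c : R[i] := (rho%:C)%C.
have nc : normc c = rho by rewrite normc_real gtr0_norm.
have onA t : A (l0 + c * expi t).
  by apply: disc; rewrite addrC addKr normcM nc normc_expi mulr1.
pose h t := M + g (l0 + c * expi t).
have p2 : 0 < pi *+ 2 :> R by have := @pi_gt0 R; lra.
have cn := @continuous_circle R l0 c.
have cl : continuous (fun t => ln (normc (l0 + c * expi t))).
  by apply: continuous_ln_pos => // t; exact/A0/onA.
have cs : continuous (fun t => normc (l0 + c * expi t) ^+ 2).
  move=> t; apply: (@continuous_comp _ _ _ (fun t => normc (l0 + c * expi t))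
    (fun x : R => x ^+ 2)); first exact: cn.
  exact: exprn_continuous.
have cls : continuous (fun t => s * ln (normc (l0 + c * expi t))).
  by move=> t; exact: cvgMr (cl t).
have csk : continuous (fun t => (- k) * normc (l0 + c * expi t) ^+ 2).
  by move=> t; exact: cvgMr (cs t).
have cM : continuous (cst M : R -> R) by move=> t; exact: cst_continuous.
have hE : h = cst M \+ ((fun t => s * ln (normc (l0 + c * expi t))) \+
    (fun t => (- k) * normc (l0 + c * expi t) ^+ 2)).
  by apply/funext => t; rewrite /h /g /= mulNr.
have cin : continuous ((fun t => s * ln (normc (l0 + c * expi t))) \+
    (fun t => (- k) * normc (l0 + c * expi t) ^+ 2)).
  by move=> t; exact: cvgD (cls t) (csk t).
have ch : continuous h by rewrite hE => t; exact: cvgD (cM t) (cin t).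
(* Over the circle of radius [rho] the majorant of [v] has a mean smaller than [v l0] by exactly
   [k * rho ^+ 2], against the mean value inequality. *)
have hint : circle_int h = (M + g l0 - k * rho ^+ 2) * (pi *+ 2).
  rewrite hE !circle_intD // !circle_intZ // circle_int_cst circle_int_ln //.
    by rewrite circle_int_sqr_normc nc /g; ring.
  by rewrite nc; lra.
have mv : measurable_fun circle (fun t => v (l0 + c * expi t)).
  apply: measurable_funTS.
  have ml : measurable_fun setT (fun t => - v (l0 + c * expi t)%R)%E.
    apply: lower_semicontinuous_measurable => t a; rewrite lteNr -EFinN => va.
    exists [set t | (v (l0 + c * expi t)%R < (- a)%:E)%E].
      have := usc _ (sub _ (onA t)) _ va.
      by move/(@continuous_expi_path l0 c t).
    by move=> y /=; rewrite lteNr -EFinN.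
  rewrite (_ : (fun t => _) = -%E \o (fun t => - v (l0 + c * expi t)%R)%E).
    exact: measurableT_comp.
  by apply/funext => t /=; rewrite oppeK.
have := integral_circle_le mv ch (fun t => vle _ (onA t)).
move=> hI; apply/negP; rewrite -ltNge vM.
rewrite lte_pdivrMl //; apply: le_lt_trans hI _.
rewrite hint -EFinM lte_fin mulrC ltr_pM2l //.
by have := mulr_gt0 k0 (exprn_gt0 2 rho0); lra.
Qed.

End maximum_principle.

(** * Green functions of Reinhardt domains *)

Section log_monomials.
Context {R : realType} {n : nat}.
Implicit Types (z w a b : 'rV[R[i]]_n) (m : multinom n).
Local Notation mu := (@lebesgue_measure R).
Local Notation circle := (`[0%R, (pi *+ 2)%R]%classic : set R).

Definition log_mon (q : nat) (A : R) m z : \bar R :=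
  ((q%:R^-1)%:E * lne (A * mon m z)%:E)%E.

Lemma log_mon_lt q A m z (x : R) : (0 < q)%N -> 0 < A ->
  (log_mon q A m z < x%:E)%E = (A * mon m z < expR (q%:R * x)).
Proof.
move=> q0 A0; rewrite /log_mon lte_pdivrMl ?ltr0n // -EFinM lne_lt //.
by rewrite mulr_ge0 ?mon_ge0 ?(ltW A0).
Qed.

Lemma log_mon_le q A m z (x : R) : (0 < q)%N -> 0 < A ->
  A * mon m z <= expR (q%:R * x) -> (log_mon q A m z <= x%:E)%E.
Proof.
move=> q0 A0 h; apply/lee_addgt0Pr => e e0; rewrite -EFinD; apply: ltW.
rewrite log_mon_lt //; apply: le_lt_trans h _.
by rewrite ltr_expR ltr_pM2l ?ltr0n // ltrDl.
Qed.

Lemma normc_le_enorm z k : normc (z ord0 k) <= enorm z.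
Proof.
rewrite -[normc _]ger0_norm ?normc_ge0 // -sqrtr_sqr ler_sqrt ?sumr_ge0 //.
  by rewrite (bigD1 k) //= lerDl sumr_ge0 // => *; exact: sqr_ge0.
by move=> *; exact: sqr_ge0.
Qed.

Lemma continuous_line a b : continuous (fun l : R[i] => a + l *: b).
Proof.
move=> l A /nbhs_polydiscP[d d0 dA].
have b0 : 0 < enorm b + 1 by rewrite ltr_wpDl // sqrtr_ge0.
apply/nbhs_normcP; exists (d / (enorm b + 1)); first exact: divr_gt0.
move=> w; rewrite ltr_pdivlMr // => hw; apply: dA => k.
rewrite !mxE opprD addrACA subrr add0r -mulrBl normcM.
apply: le_lt_trans hw; rewrite ler_wpM2l ?normc_ge0 //.
by apply: le_trans (normc_le_enorm b k) _; rewrite lerDl.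
Qed.

(** Coordinates are affine along a complex line, so on a circle the monomial is a product of powers
    of [normc (a + b * expi t)], to which [jensen_linear] applies. If it vanishes at the center, the
    value there is [-oo]. *)
Lemma plurisubharmonic_log_mon q A m (Omega : set 'rV[R[i]]_n) :
  (0 < q)%N -> 0 < A -> plurisubharmonic Omega (log_mon q A m).
Proof.
move=> q0 A0; have q0R : (0 : R) < q%:R by rewrite ltr0n.
have usc z (x : R) : (log_mon q A m z < x%:E)%E ->
    \forall w \near z, (log_mon q A m w < x%:E)%E.
  rewrite log_mon_lt // => h.
  have op : open [set w : 'rV[R[i]]_n | A * mon m w < expR (q%:R * x)].
    have -> : [set w : 'rV[R[i]]_n | A * mon m w < expR (q%:R * x)] =
        mon m @^-1` [set y | y < expR (q%:R * x) / A].
      by apply/seteqP; split => w /=; rewrite ltr_pdivlMr // mulrC.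
    by apply: open_comp => [w _|]; [exact: continuous_mon | exact: open_lt].
  apply: filterS (open_nbhs_nbhs (conj op h)) => w.
  by rewrite log_mon_lt.
have finite z : (log_mon q A m z < +oo)%E.
  rewrite /log_mon; have := lne_neqy (A * mon m z); case: (lne _) => [x| |] // _.
    by rewrite ltry.
  by rewrite gt0_muleNy ?lte_fin ?invr_gt0 // ltNyr.
split => [z _||a b]; [exact: usc | by move=> z _; exact: finite |].
split => [l _ x h|l _|c r r0 _].
- exact: (continuous_line (usc _ _ h)).
- exact: finite.
have [|nz] := eqVneq (mon m (a + c *: b)) 0.
  by move=> h; rewrite {1}/log_mon h mulr0 le0_lneNy // gt0_muleNy ?lte_fin ?invr_gt0 // leNye.
pose F k (t : R) := normc ((a ord0 k + c * b ord0 k) + ((r%:C)%C * b ord0 k) * expi t) ^+ m k.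
have jF k : jensen (F k) (normc (a ord0 k + c * b ord0 k) ^+ m k).
  (* A coordinate of exponent [0] may vanish at the center, where [jensen_linear] would not
     apply. *)
  rewrite /F; have [->|mk] := eqVneq (m k) 0%N.
    by under [X in jensen X _]eq_fun do rewrite expr0; rewrite expr0; exact: jensen_cst.
  apply: jensen_exp; apply: jensen_linear; rewrite lt_def normc_ge0 andbT.
  move/prodf_neq0 : nz => /(_ k isT); rewrite !mxE expf_eq0 lt0n mk /=.
  by apply: contraNneq => ->.
have := jensenM (jensen_cst A0) (jensen_prod (index_enum 'I_n) jF).
have -> : (fun t => cst A t * \prod_(k < n) F k t) =
    (fun t => A * mon m (a + (c + (r%:C)%C * expi t) *: b)).
  apply/funext => t; congr (_ * _); apply: eq_bigr => k _.
  by rewrite /F !mxE; congr (normc _ ^+ _); ring.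
have -> : \prod_(k < n) normc (a ord0 k + c * b ord0 k) ^+ m k = mon m (a + c *: b).
  by apply: eq_bigr => k _; rewrite !mxE.
move=> [m0 _ int hI].
have p2 : 0 < pi *+ 2 :> R by have := @pi_gt0 R; lra.
rewrite /log_mon integralZl // muleCA lee_pmul2l ?lte_fin ?invr_gt0 //.
by rewrite lne_EFin // lee_pdivlMl // -EFinM mulrC.
Qed.

Lemma plurisubharmonic0 (Omega : set 'rV[R[i]]_n) :
  plurisubharmonic Omega (fun=> 0%E).
Proof.
split => [z _ x|z _|a b].
- by move=> x0; near=> y.
- exact: ltry.
split => [l _ x x0|l _|c r r0 _]; [by near=> y | exact: ltry |].
by rewrite integral0_eq // mule0.
Unshelve. all: by end_near. Qed.

Lemma enorm_gt0 z : z != 0 -> 0 < enorm z.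
Proof.
move=> /rV0Pn[k zk]; apply: lt_le_trans (normc_le_enorm z k).
by rewrite normc_gt0.
Qed.

Lemma enormZ (l : R[i]) z : enorm (l *: z) = normc l * enorm z.
Proof.
rewrite /enorm (eq_bigr (fun k => normc l ^+ 2 * normc (z ord0 k) ^+ 2)).
  by rewrite -mulr_sumr sqrtrM ?sqr_ge0 // sqrtr_sqr ger0_norm ?normc_ge0.
by move=> k _; rewrite mxE normcM exprMn.
Qed.

Lemma mon_le_enorm m z : mon m z <= enorm z ^+ mdeg m.
Proof.
rewrite mdegE expr_sum; apply: ler_prod => k _.
rewrite exprn_ge0 ?normc_ge0 //= lerXn2r ?nnegrE ?normc_ge0 ?normc_le_enorm //.
exact: sqrtr_ge0.
Qed.

End log_monomials.

Section green_functions.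
Context {R : realType} {n : nat} (D : set 'rV[R[i]]_n).
Hypothesis D_domain : domain D.
Hypothesis D_bounded : bounded_set D.
Hypothesis D_polyconvex : polynomially_convex D.
Hypothesis D_reinhardt : reinhardt D.
Implicit Types (z w : 'rV[R[i]]_n) (t : R).

Lemma scale_sub (t : R) (l : R[i]) z : 0 < t -> D ((t^-1%:C)%C *: z) ->
  normc l * t <= 1 -> D (l *: z).
Proof.
move=> t0 Dz lt; apply: (reinhardt_complete D_bounded D_polyconvex D_reinhardt Dz) => k.
rewrite !mxE !normcM ler_wpM2r ?normc_ge0 // normc_real ger0_norm ?invr_ge0 ?(ltW t0) //.
by rewrite -div1r ler_pdivlMr.
Qed.

(** The Minkowski gauge as an infimum: finite because [D] contains a polydisc about [0], positive
    because [D] is bounded. The case [t = h] is left open; the estimates approach [h] from both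
    sides. *)
Lemma exists_gauge z : z != 0 -> exists2 h : R, 0 < h &
  (forall t, h < t -> D ((t^-1%:C)%C *: z)) /\
  (forall t, 0 < t -> t < h -> ~ D ((t^-1%:C)%C *: z)).
Proof.
move=> z0; pose S := [set t : R | 0 < t /\ D ((t^-1%:C)%C *: z)].
have [B B0 DB] := bounded_normc D_bounded.
have [d d0 dD] := polydisc_sub D_domain D_bounded D_polyconvex D_reinhardt.
have [k zk] : exists k, z ord0 k != 0 by apply/rV0Pn.
have lb : lbound S (normc (z ord0 k) / B).
  move=> t [t0 /DB/(_ k)]; rewrite mxE normcM normc_real ger0_norm ?invr_ge0 ?(ltW t0) //.
  by rewrite mulrC ler_pdivrMr // ler_pdivrMr // mulrC.
have S0 : S !=set0.
  have e0 : 0 < (enorm z + 1) / d by rewrite divr_gt0 // ltr_wpDl // sqrtr_ge0.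
  exists ((enorm z + 1) / d); split => //; apply: dD => j.
  rewrite mxE normcM normc_real ger0_norm ?invr_ge0 ?(ltW e0) // invf_div.
  rewrite mulrAC ltr_pdivrMr ?ltr_wpDl ?sqrtr_ge0 // ltr_pM2l //.
  by apply: le_lt_trans (normc_le_enorm z j) _; rewrite ltrDl.
have iS : has_inf S by split => //; exists (normc (z ord0 k) / B).
exists (inf S).
  by apply: lt_le_trans (lb_le_inf S0 lb); rewrite divr_gt0 ?normc_gt0.
split=> [t ht|t t0 th Dt].
  have e0 : 0 < t - inf S by rewrite subr_gt0.
  have [u [u0 Du]] := inf_adherent e0 iS; rewrite addrC subrK => ut.
  apply: (scale_sub u0 Du); rewrite normc_real ger0_norm ?invr_ge0; last lra.
  by rewrite mulrC ler_pdivrMr; lra.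
have : inf S <= t by apply: ge_inf; [exact: iS.2 | split].
by rewrite leNgt th.
Qed.

(** On the line through [0] and [z], [u] is compared with [(1 - eps) * ln (normc l) + B], where [B]
    makes the bound vanish on the outer circle of radius [1 / t]. The reduced slope lets a small
    inner circle pay for the unknown [C]; at [l = 1] the bound is [B], close to [ln t]. *)
Lemma green_le z t : D z -> z != 0 -> 0 < t -> D ((t^-1%:C)%C *: z) ->
  (pluricomplex_green D 0 z <= (ln t)%:E)%E.
Proof.
move=> Dz1 z0 t0 Dz; apply: ge_ereal_sup => _ [u [psh u0 [C Cu]] <-].
have [t1|t1] := leP t 1; last first.
  by apply: le_trans (ltW (u0 z Dz1)) _; rewrite lee_fin ln_ge0 // ltW.
have lt0 : ln t <= 0 by rewrite ln_le0.
have [d d0 dC] : exists2 d : R, 0 < d & forall w, w != 0 ->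
    (forall k, normc (w ord0 k) < d) -> (u w <= (ln (enorm w) + C)%:E)%E.
  have /nbhs_polydiscP[d d0 dA] := Cu.
  exists d => // w w0 wd; rewrite -[X in enorm X]subr0; apply: (dA w) => //.
  by move=> k; rewrite mxE subr0.
have Ez := enorm_gt0 z0.
apply/lee_addgt0Pr => e e0; rewrite -EFinD.
have e10 : 0 < 1 - ln t by lra.
pose eps := Num.min (1 / 2) (e / (1 - ln t)).
have eps0 : 0 < eps by rewrite lt_min !divr_gt0.
have eps1 : eps <= 1 / 2 by rewrite ge_min lexx.
have eps2 : eps * (1 - ln t) <= e by rewrite -ler_pdivlMr // ge_min lexx orbT.
pose B := (1 - eps) * ln t.
(* The three terms put [1] inside the annulus, absorb [C] on the inner circle, and place that circle
   where the bound at the pole holds. *)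
pose y := Num.min (- 1) (Num.min ((B - C - ln (enorm z)) / eps) (ln (d / (2 * enorm z)))).
pose r1 := expR y.
have r10 : 0 < r1 by exact: expR_gt0.
have y1 : y <= -1 by rewrite ge_min lexx.
have y2 : eps * y <= B - C - ln (enorm z).
  by rewrite mulrC -ler_pdivlMr // !ge_min lexx orbT.
have y3 : r1 * enorm z < d.
  rewrite -ltr_pdivlMr //.
  apply: (@le_lt_trans _ _ (d / (2 * enorm z))); last first.
    by rewrite ltr_pM2l // ltf_pV2 ?posrE ?mulr_gt0 // ltr_pMl // ltr1n.
  rewrite -[leRHS]lnK ?posrE ?divr_gt0 ?mulr_gt0 // ler_expR.
  by rewrite !ge_min lexx !orbT.
have r11 : r1 <= 1 by rewrite expR_le1; lra.
have [_ _ /(_ 0 z) sub] := psh.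
have nr1 : normc (1 : R[i]) = 1 by exact: normc1.
have := @annulus_maximum R [set l | D (0 + l *: z)] (fun l => u (0 + l *: z))
  r1 t^-1 (1 - eps) B sub r10 _ _ 1.
rewrite nr1 ln1 mulr0 add0r scale1r add0r => H.
apply: le_trans (H _ _ _) _.
- move=> l /andP[_ lt]; rewrite /= add0r; apply: (scale_sub t0 Dz).
  by rewrite -ler_pdivlMr // div1r.
- move=> l [lE|lE]; rewrite add0r lE.
    have l0 : l != 0 by rewrite -normc_gt0 lE.
    apply: le_trans (dC _ _ _) _.
    + by rewrite scaler_eq0 negb_or l0.
    + move=> k; apply: le_lt_trans (normc_le_enorm _ k) _.
      by rewrite enormZ lE.
    + rewrite enormZ lE lnM ?posrE // lee_fin expRK; lra.
  have Dl : D (l *: z) by apply: (scale_sub t0 Dz); rewrite lE mulVf ?gt_eqF.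
  apply: le_trans (ltW (u0 _ Dl)) _.
  by rewrite lnV ?posrE // lee_fin /B; lra.
- by rewrite r11 invf_ge1.
- by rewrite lee_fin /B; lra.
Qed.

(** The mirror image of [green_le]: on the line through [w = z / t], [u] is at most [0] on the unit
    circle, and slope [1 + eps] absorbs [C] on a large outer circle. The bound is read at
    [l = t]. *)
Lemma green_at_infinity_le z t : 1 <= t -> D ((t^-1%:C)%C *: z) ->
  (green_at_infinity (closure D) z <= (ln t)%:E)%E.
Proof.
move=> t1 Dz; have t0 : 0 < t by lra.
apply: ge_ereal_sup => _ [u [psh u0 [C Cu]] <-].
have lt0 : 0 <= ln t by rewrite ln_ge0.
pose w := (t^-1%:C)%C *: z.
have zw : z = (t%:C)%C *: w by rewrite scalerA -rmorphM /= divff ?gt_eqF // scale1r.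
have Ew : 0 <= enorm w by exact: sqrtr_ge0.
apply/lee_addgt0Pr => e e0; rewrite -EFinD.
have e10 : 0 < 1 + ln t by lra.
pose eps := e / (1 + ln t).
have eps0 : 0 < eps by rewrite divr_gt0.
have eps2 : eps * (1 + ln t) = e by rewrite divfK ?gt_eqF.
pose y := Num.max (ln t) ((ln (1 + enorm w) + C) / eps).
pose r2 := expR y.
have y1 : ln t <= y by rewrite le_max lexx.
have y2 : ln (1 + enorm w) + C <= eps * y.
  by rewrite mulrC -ler_pdivrMr // le_max lexx orbT.
have r2t : t <= r2 by rewrite -[leLHS]lnK ?posrE // ler_expR.
have [_ _ /(_ 0 w) sub] := psh.
have nt : normc (t%:C)%C = t by rewrite normc_real gtr0_norm.
have := @annulus_maximum R setT (fun l => u (0 + l *: w)) 1 r2 (1 + eps) 0 sub ltr01 _ _ (t%:C)%C.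
rewrite nt add0r -zw addr0 => H.
apply: le_trans (H _ _ _) _ => //.
- move=> l [lE|lE]; rewrite add0r lE.
    rewrite ln1 mulr0 addr0; apply/u0/subset_closure.
    rewrite scalerA; apply: (scale_sub t0 Dz).
    by rewrite normcM lE mul1r normc_real ger0_norm ?invr_ge0 ?(ltW t0) // mulVf ?gt_eqF.
  apply: le_trans (Cu _) _; rewrite lee_fin enormZ lE addr0 expRK.
  have : ln (1 + r2 * enorm w) <= ln (r2 * (1 + enorm w)).
    have r21 : 1 <= r2 by lra.
    rewrite ler_ln ?posrE ?mulr_gt0 ?expR_gt0 ?ltr_wpDr ?mulr_ge0 ?expR_ge0 //.
    by rewrite mulrDr mulr1 lerD2r.
  by rewrite lnM ?posrE ?expR_gt0 ?ltr_wpDr // expRK; lra.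
- by rewrite t1.
- by rewrite lee_fin; lra.
Qed.

Lemma exists_log_mon z t (e : R) : 0 < t -> 0 < e -> ~ D ((t^-1%:C)%C *: z) ->
  exists q A m, [/\ (0 < q)%N, 0 < A, mdeg m = q,
    ((ln t - e)%:E <= log_mon q A m z)%E &
    forall w, closure D w -> (log_mon q A m w < 0)%E].
Proof.
(* One factor [r] is lost in [uniform_monomials], a second one goes into [A] to make the competitor
   strictly negative on the closure; together they cost [e]. *)
move=> t0 e0 Dz; pose r : R := expR (- (e / 2)).
have r01 : 0 < r < 1 by rewrite expR_gt0 expR_lt1; lra.
have [q q0 qP] := uniform_monomials D_domain D_bounded D_polyconvex D_reinhardt r01.
have [m mq hm] := qP t z t0 Dz.
have s0 := supmon_gt0 D_domain D_bounded D_polyconvex D_reinhardt m.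
have q0R : (0 : R) < q%:R by rewrite ltr0n.
have A0 : 0 < r ^+ q / supmon D m by rewrite divr_gt0 ?exprn_gt0 ?expR_gt0.
exists q, (r ^+ q / supmon D m), m; split => //.
  rewrite leNgt log_mon_lt // -leNgt.
  have -> : expR (q%:R * (ln t - e)) = (r * (r * t)) ^+ q.
    rewrite expRM_natl; congr (_ ^+ _).
    by rewrite -[in RHS](lnK (t0 : t \is Num.pos)) -!expRD; congr expR; field.
  rewrite exprMn -mulrA ler_wpM2l ?exprn_ge0 ?expR_ge0 //.
  by rewrite ler_pdivlMl // mulrC.
move=> w Dw; rewrite log_mon_lt // mulr0 expR0.
apply: (@le_lt_trans _ _ (r ^+ q)).
  rewrite mulrAC ler_pdivrMr // ler_wpM2l ?exprn_ge0 ?expR_ge0 //.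
  exact: (le_supmon D_bounded).
by have /andP[h1 h2] := r01; rewrite exprn_ilt1 ?(ltW h1) // -lt0n.
Qed.

Lemma log_mon_le_ln q A m z (x : R) : (0 < q)%N -> 0 < A -> mdeg m = q ->
  0 < x -> enorm z <= x ->
  (log_mon q A m z <= (ln x + ln A / q%:R)%:E)%E.
Proof.
move=> q0 A0 mq x0 zx; apply: log_mon_le => //.
rewrite mulrDr mulrCA divff ?mulr1 ?gt_eqF ?ltr0n // expRD expRM_natl !lnK //.
rewrite mulrC ler_pM2r //; apply: le_trans (mon_le_enorm m z) _.
by rewrite mq lerXn2r ?nnegrE ?(ltW x0) // sqrtr_ge0.
Qed.

Lemma green_ge z t : 0 < t -> ~ D ((t^-1%:C)%C *: z) ->
  ((ln t)%:E <= pluricomplex_green D 0 z)%E.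
Proof.
move=> t0 Dz; apply/lee_subgt0Pr => e e0.
have [q [A [m [q0 A0 mq hz hD]]]] := exists_log_mon t0 e0 Dz.
apply: le_ereal_sup_tmp; exists (log_mon q A m z) => //.
exists (log_mon q A m) => //; split.
- exact: plurisubharmonic_log_mon.
- by move=> w Dw; apply/hD/subset_closure.
- exists (ln A / q%:R).
  apply/nbhs_polydiscP; exists 1 => // w _ w0.
  by rewrite subr0; apply: log_mon_le_ln => //; exact: enorm_gt0.
Qed.

Lemma green_at_infinity_ge z t : 0 < t -> ~ D ((t^-1%:C)%C *: z) ->
  ((ln t)%:E <= green_at_infinity (closure D) z)%E.
Proof.
move=> t0 Dz; apply/lee_subgt0Pr => e e0.
have [q [A [m [q0 A0 mq hz hD]]]] := exists_log_mon t0 e0 Dz.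
apply: le_ereal_sup_tmp; exists (log_mon q A m z) => //.
exists (log_mon q A m) => //; split.
- exact: plurisubharmonic_log_mon.
- by move=> w Dw; apply/ltW/hD.
- exists (ln A / q%:R) => w.
  by apply: log_mon_le_ln => //; rewrite ?ltr_wpDr ?sqrtr_ge0 // lerDr.
Qed.

Lemma green_at_infinity_ge0 z : (0 <= green_at_infinity (closure D) z)%E.
Proof.
apply: le_ereal_sup_tmp; exists 0%E => //; exists (fun=> 0%E) => //; split => //.
- exact: plurisubharmonic0.
- exists 0 => w; rewrite lee_fin addr0 ln_ge0 // lerDl; exact: sqrtr_ge0.
Qed.

Lemma green_at_infinity0 : green_at_infinity (closure D) 0 = 0%E.
Proof.
apply/eqP; rewrite eq_le green_at_infinity_ge0 andbT.
have := @green_at_infinity_le 0 1 (lexx _); rewrite ln1; apply; rewrite scaler0.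
exact: domain0 D_domain D_bounded D_polyconvex D_reinhardt.
Qed.

End green_functions.

(** * Distance from [log_max] to the two Green functions *)

Lemma lt_abse_sub (R : realType) (u v : \bar R) (x a b e : R) :
  ((x - a)%:E <= u <= (x + a)%:E)%E -> ((x - b)%:E <= v <= (x + b)%:E)%E ->
  a + b < e -> (`|u - v| < e%:E)%E.
Proof.
move=> /andP[h1 h2] /andP[h3 h4] abe.
have uf : u \is a fin_num.
  by rewrite fin_numElt (lt_le_trans (ltNyr _) h1) (le_lt_trans h2 (ltry _)).
have vf : v \is a fin_num.
  by rewrite fin_numElt (lt_le_trans (ltNyr _) h3) (le_lt_trans h4 (ltry _)).
rewrite -(fineK uf) -(fineK vf) !lee_fin in h1 h2 h3 h4 *.
rewrite -EFinB lte_fin ltr_norml.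
by apply/andP; split; lra.
Qed.

Section convergence.
Context {R : realType} {n : nat} (D : set 'rV[R[i]]_n).
Hypothesis D_domain : domain D.
Hypothesis D_bounded : bounded_set D.
Hypothesis D_polyconvex : polynomially_convex D.
Hypothesis D_reinhardt : reinhardt D.
Variables (P : 'I_n -> mpoly n R[i]) (q : nat) (a : R).
Hypothesis a0 : 0 < a.
Hypothesis q0 : (0 < q)%N.
Hypothesis vP : forall (t : R) z, 0 < t ->
  (D ((t^-1%:C)%C *: z) -> (log_max P q z <= (ln t + a)%:E)%E) /\
  (~ D ((t^-1%:C)%C *: z) -> ((ln t - a)%:E <= log_max P q z)%E).
Implicit Types z : 'rV[R[i]]_n.

Lemma log_max_eqNy z : (forall k, peval (P k) z = 0) -> log_max P q z = -oo%E.
Proof.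
move=> Pz; rewrite /log_max big1_idem ?maxxx // => [|k _].
  by rewrite gt0_muleNy // lte_fin invr_gt0 ltr0n.
by rewrite Pz normc0 le0_lneNy.
Qed.

(** The origin is in [D] at every scale [t], so [log_max] at [0] is at most [ln t + a] for
    arbitrarily small [t]. *)
Lemma peval0_eq0 k : peval (P k) 0 = 0.
Proof.
have D0 := domain0 D_domain D_bounded D_polyconvex D_reinhardt.
apply/eqP; rewrite -normc_eq0; apply: contraT => p0.
have {}p0 : 0 < normc (peval (P k) 0) by rewrite lt_def p0 normc_ge0.
have q0R : (0 : R) < q%:R by rewrite ltr0n.
pose y := ln (normc (peval (P k) 0)) / q%:R.
have h1 : (y%:E <= log_max P q 0)%E.
  by apply: (@log_max_ge _ _ _ _ _ _ k) => //; rewrite /y mulrC divfK ?gt_eqF // lnK.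
have [h2 _] := vP 0 (expR_gt0 (y - a - 1)).
have := le_trans h1 (h2 _); rewrite scaler0 => /(_ D0).
by rewrite lee_fin expRK; have := a0; lra.
Qed.

(** Below the gauge of a nonzero [z], the lower bound keeps [log_max] away from [-oo]. *)
Lemma common_zero z : (forall k, peval (P k) z = 0) <-> z = 0.
Proof.
split=> [Pz|-> k]; last exact: peval0_eq0.
apply/eqP; apply: contraT => z0.
have [h h0 [_ hz]] := exists_gauge D_domain D_bounded D_polyconvex D_reinhardt z0.
have h2 : 0 < h / 2 by lra.
have h3 : h / 2 < h by lra.
have := (vP z h2).2 (hz _ h2 h3).
by rewrite log_max_eqNy // leeNy_eq.
Qed.

(** The bounds are taken at [h * expR a] and [h * expR (- a)]; leaving the undecided value [t = h]
    costs one more [a]. *)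
Lemma gauge_squeeze (c : R) (u : \bar R) (h : R) : 0 < h ->
  (forall t, h < t -> (u <= (ln t + c)%:E)%E) ->
  (forall t, 0 < t -> t < h -> ((ln t - c)%:E <= u)%E) ->
  ((ln h - (c + a))%:E <= u <= (ln h + (c + a))%:E)%E.
Proof.
move=> h0 up lo; apply/andP; split.
  apply: le_trans (lo (h * expR (- a)) _ _).
  - by rewrite lnM ?posrE ?expR_gt0 // expRK lee_fin; lra.
  - by rewrite mulr_gt0 ?expR_gt0.
  - by rewrite gtr_pMr // expR_lt1 oppr_lt0.
apply: le_trans (up (h * expR a) _) _.
- by rewrite ltr_pMr // expR_gt1.
- by rewrite lnM ?posrE ?expR_gt0 // expRK lee_fin; lra.
Qed.

Lemma log_max_green z : D z -> z != 0 ->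
  (`|log_max P q z - pluricomplex_green D 0 z| < (4 * a)%:E)%E.
Proof.
move=> Dz z0.
have [h h0 [hz1 hz2]] := exists_gauge D_domain D_bounded D_polyconvex D_reinhardt z0.
apply: (@lt_abse_sub _ _ _ (ln h) (a + a) (0 + a)); last by have := a0; lra.
  apply: gauge_squeeze => // t.
    by move=> ht; apply: (vP z _).1; [lra | exact: hz1].
  by move=> t0 th; apply: (vP z t0).2; exact: hz2.
apply: gauge_squeeze => // t.
  move=> ht; rewrite addr0; apply: green_le => //; first lra.
  exact: hz1.
by move=> t0 th; rewrite subr0; apply: green_ge => //; exact: hz2.
Qed.

Lemma log_max_green_at_infinity z :
  (`|maxe (log_max P q z) 0 - green_at_infinity (closure D) z| < (4 * a)%:E)%E.
Proof.
(* The origin has no positive gauge; there [log_max] is [-oo], and its truncation agrees with the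
   Green function. *)
have [->|z0] := eqVneq z 0.
  rewrite log_max_eqNy; last exact: peval0_eq0.
  rewrite green_at_infinity0 // maxNye sube0 abse0 lte_fin; have := a0; lra.
have [h h0 [hz1 hz2]] := exists_gauge D_domain D_bounded D_polyconvex D_reinhardt z0.
have := gauge_squeeze h0 (fun t ht => (vP z (lt_trans h0 ht)).1 (hz1 t ht))
  (fun t t0 th => (vP z t0).2 (hz2 t t0 th)).
move=> /andP[v1 v2].
set V := green_at_infinity _ _.
have V0 : (0 <= V)%E by exact: green_at_infinity_ge0.
have V1 : ((ln h - a)%:E <= V)%E.
  have t0 : 0 < h * expR (- a) by rewrite mulr_gt0 ?expR_gt0.
  have -> : ln h - a = ln (h * expR (- a)).
    by rewrite lnM ?posrE ?expR_gt0 // expRK.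
  apply: green_at_infinity_ge => //; apply: hz2 => //.
  by rewrite gtr_pMr // expR_lt1 oppr_lt0.
have V2 : (V <= (Num.max (ln h) 0 + a)%:E)%E.
  have -> : Num.max (ln h) 0 + a = ln (Num.max h 1 * expR a).
    rewrite lnM ?posrE ?expR_gt0 ?lt_max ?h0 // expRK; congr (_ + _).
    have [h1|h1] := leP h 1.
      by rewrite ln1 max_r // ln_le0.
    by rewrite max_l // ln_ge0 // ltW.
  have m1 : 1 <= Num.max h 1 by rewrite le_max lexx orbT.
  have a1 : 1 < expR a by rewrite expR_gt1.
  apply: green_at_infinity_le => //; first nra.
  apply: hz1; apply: (@le_lt_trans _ _ (Num.max h 1)); first by rewrite le_max lexx.
  by rewrite ltr_pMr //; lra.
apply: (@lt_abse_sub _ _ _ (Num.max (ln h) 0) (a + a) a); last by have := a0; lra.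
  apply/andP; split.
    have [l0|l0] := leP (ln h) 0.
      by rewrite le_max lee_fin; apply/orP; right; have := a0; lra.
    by rewrite le_max v1.
  rewrite ge_max (le_trans v2) ?lee_fin ?lerD2r ?le_max ?lexx //=.
  have : 0 <= Num.max (ln h) 0 by rewrite le_max lexx orbT.
  by have := a0; lra.
rewrite V2 andbT; have [l0|l0] := leP (ln h) 0.
  by apply: le_trans V0; rewrite lee_fin; have := a0; lra.
exact: V1.
Qed.

End convergence.

Theorem theorem1p1 (R : realType) (n : nat) (n_gt0 : (0 < n)%N)
    (D : set 'rV[R[i]]_n) (D_domain : domain D) (D_bounded : bounded_set D)
    (D_polyconvex : polynomially_convex D) (D_reinhardt : reinhardt D) :
  exists (P : nat -> 'I_n -> mpoly n R[i]) (q : nat -> nat),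
    [/\ forall s,
          [/\ (0 < q s)%N,
              forall k, P s k \is ishomog1 (q s) mdeg &
              forall z : 'rV[R[i]]_n,
                (forall k, peval (P s k) z = 0) <-> z = 0],
        uniform_cvg_on (D `\ 0)
          (fun s => log_max (P s) (q s)) (pluricomplex_green D 0) &
        uniform_cvg_on setT
          (fun s z => maxe (log_max (P s) (q s) z) 0%E)
          (green_at_infinity (closure D))].
Proof.
(* Stage [s] has accuracy [1 / (s + 1)], so both distances stay below [4 / (s + 1)]. *)
have a0 (s : nat) : 0 < (s.+1%:R^-1 : R) by rewrite invr_gt0 ltr0n.
have /choice[Pq PqP] s := approx_log_max D_domain D_bounded D_polyconvex
  D_reinhardt n_gt0 (a0 s).
have /choice[q qP] := PqP.
exists Pq, q.
have small (e : R) : 0 < e -> \forall s \near \oo, 4 * s.+1%:R^-1 <= e.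
  move=> e0; exists (Num.bound (4 / e)) => // s /= es.
  rewrite ler_pdivrMr ?ltr0n // mulrC -ler_pdivrMr //.
  have /archi_boundP/ltW/le_trans : 0 <= 4 / e by rewrite divr_ge0 // ltW.
  by apply; rewrite ler_nat leqW.
split.
- move=> s; have [q0 hom vP] := qP s; split => // z.
  exact: (common_zero D_domain D_bounded D_polyconvex D_reinhardt (a0 s) q0 vP).
- move=> e /small; apply: filterS => s es z [Dz /eqP z0].
  have [q0 hom vP] := qP s; apply: lt_le_trans
    (log_max_green D_domain D_bounded D_polyconvex D_reinhardt (a0 s) vP Dz z0) _.
  by rewrite lee_fin.
- move=> e /small; apply: filterS => s es z _.
  have [q0 hom vP] := qP s; apply: lt_le_trans
    (log_max_green_at_infinity D_domain D_bounded D_polyconvex D_reinhardt (a0 s) q0 vP z) _.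
  by rewrite lee_fin.
Qed.
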